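(* Let $X(\boldsymbol{s})$ be a stationary, mean-square differentiable Gaussian random field on a planar domain $\mathcal{D}\subset\mathbb{R}^2$ with short-ranged covariance function $c(\boldsymbol{r})$ whose spectral density satisfies $\tilde{C}(\boldsymbol{k})=\mathcal{O}(\|\boldsymbol{k}\|^{-3-\epsilon})$ for some $\epsilon>0$ as $\|\boldsymbol{k}\|\to\infty$. Let $\boldsymbol{Q}^{\ast}$, $\hat{\mathbb{Q}}$, $\boldsymbol{C}_{\hat{\mathbb{Q}}}$ be as defined in the context, and let $(\hat{R},\hat{\theta})$ be the anisotropy statistics. Then the joint probability density function of $\hat{R}$ and $\hat{\theta}$ is given asymptotically (in the sense made explicit in the context), for $R>0$ and $\theta\in[-\pi/4,\pi/4)$, by $$ f_{\hat{R},\hat{\theta}}(R,\theta;\boldsymbol{Q}^{\ast},\boldsymbol{C}_{\hat{\mathbb{Q}}}) = \frac{2R\,|R^2-1|\; f_{\hat{\boldsymbol{q}}}(\boldsymbol{q};\boldsymbol{Q}^{\ast},\boldsymbol{C}_{\hat{\mathbb{Q}}})}{\left(R^2\cos^2\theta+\sin^2\theta\right)^3}, $$ where $\boldsymbol{q}=(q_{\mathrm d},q_{\mathrm o})^t$ is expressed through $(R,\theta)$ by $$ q_{\mathrm d}=\frac{1+R^2\tan^2\theta}{R^2+\tan^2\theta},\qquad q_{\mathrm o}=\frac{\tan\theta\,(R^2-1)}{R^2+\tan^2\theta}, $$ and $$ f_{\hat{\boldsymbol{q}}}(\boldsymbol{q};\boldsymbol{Q}^{\ast},\boldsymbol{C}_{\hat{\mathbb{Q}}})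 = \frac{\lambda_2\, e^{-N\tilde{\lambda}_1}}{\sqrt{2}\,z_1^3}\Big[\sqrt{\pi}\,(2y^2N+1)\,\exp(y^2N)\,\operatorname{erfc}(y\sqrt{N})-2y\sqrt{N}\Big], $$ with, for $\boldsymbol{q}'=(1,q_{\mathrm d},q_{\mathrm o})^t$, $$ z_1=\big(\boldsymbol{q}'^{t}\boldsymbol{C}_{\hat{\mathbb{Q}}}^{-1}\boldsymbol{q}'\big)^{1/2},\quad z_2=-2\,\boldsymbol{Q}^{\ast t}\boldsymbol{C}_{\hat{\mathbb{Q}}}^{-1}\boldsymbol{q}',\quad \lambda_1=\boldsymbol{Q}^{\ast t}\boldsymbol{C}_{\hat{\mathbb{Q}}}^{-1}\boldsymbol{Q}^{\ast},\quad \lambda_2=(2\pi)^{-3/2}[\det\boldsymbol{C}_{\hat{\mathbb{Q}}}]^{-1/2}, $$ $$ y\sqrt{N}=\frac{z_2}{2\sqrt{2}\,z_1},\qquad 2N\tilde{\lambda}_1=\lambda_1 . $$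
   Context: Setting. $X(\boldsymbol{s})$, $\boldsymbol{s}\in\mathcal{D}\subset\mathbb{R}^2$, is a wide-sense stationary Gaussian random field with constant mean, covariance function $c(\boldsymbol{r})$, first-order differentiable in the mean-square sense (so $\partial^2c/\partial r_i^2$ exist at $\boldsymbol{r}=\boldsymbol{0}$). Short-ranged means $\int d\boldsymbol{r}\,|c(\boldsymbol{r})|<\infty$. The spectral density is $\tilde{C}(\boldsymbol{k})=\int d\boldsymbol{r}\,e^{-\mathrm{i}\boldsymbol{k}\cdot\boldsymbol{r}}c(\boldsymbol{r})$. The condition $\tilde C(\boldsymbol{k})=\mathcal{O}(\|\boldsymbol{k}\|^{-3-\epsilon})$ means that there are $\epsilon>0$, $C_\infty>0$ with $\tilde C(\boldsymbol{k})\le C_\infty/\|\boldsymbol{k}\|^{3+\epsilon}$ for all sufficiently large $\|\boldsymbol{k}\|$. Gradient tensor. $X_{ij}(\boldsymbol{s})=\partial_iX(\boldsymbol{s})\,\partial_jX(\boldsymbol{s})$, $Q^\ast_{ij}=\mathbb{E}[X_{ij}(\boldsymbol{s})]$, and $\boldsymbol{Q}^\ast$ also denotes the vector $(Q^\ast_{11},Q^\ast_{22},Q^\ast_{12})^t$. For sampling locations $\boldsymbol{s}_1,\dots,\boldsymbol{s}_N$, $\hat{Q}_{ij}=\frac1N\sum_{k=1}^N X_{ij}(\boldsymbol{s}_k)$, $\hat{\mathbb{Q}}=(\hat{Q}_{11},\hat{Q}_{22},\hat{Q}_{12})^t$, and $\boldsymbol{C}_{\hat{\mathbb{Q}}}$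 is the $3\times3$ covariance matrix of $\hat{\mathbb{Q}}$, assumed positive definite. Ratios and anisotropy statistics. $\hat{\boldsymbol{q}}=(\hat q_{\mathrm d},\hat q_{\mathrm o})^t=(\hat Q_{22}/\hat Q_{11},\hat Q_{12}/\hat Q_{11})^t$. The statistics $(\hat R,\hat\theta)$ are the solution of $\hat q_{\mathrm d}=\frac{1+\hat R^2\tan^2\hat\theta}{\hat R^2+\tan^2\hat\theta}$, $\hat q_{\mathrm o}=\frac{\tan\hat\theta(\hat R^2-1)}{\hat R^2+\tan^2\hat\theta}$, with $\hat R\in[0,\infty)$, $\hat\theta\in[-\pi/4,\pi/4)$. The map $(q_{\mathrm d},q_{\mathrm o})\mapsto(R,\theta)$ is one-to-one except at $(1,0)$, which corresponds to the line $R=1$. Meaning of ''asymptotically''. The asymptotic regime is $N\to\infty$ and $|\mathcal D|\to\infty$ with both ratios of domain length to correlation length tending to infinity, so that the Central Limit Theorem applies to $\hat{\mathbb Q}$: the density of $\hat{\mathbb{Q}}$ is then the trivariate Gaussian density $f_{\hat{\mathbb Q}}$ with mean $\boldsymbol{Q}^\ast$ and covariance $\boldsymbol{C}_{\hat{\mathbb{Q}}}$. The asymptotic densities of $\hat{\boldsymbol q}$ and of $(\hat R,\hat\theta)$ are those induced from $f_{\hat{\mathbb Q}}$ by change of variables, where the eliminated variable $u=Q_{11}$ ranges over $[0,\infty)$ (since $\hat Q_{11}\ge0$): $f_{\hat{\boldsymbol q}}(\boldsymbol q)=\int_0^\infty f_{\hat{\mathbb Q}}(Q_{11}=u,\,Q_{22}=q_{\mathrm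 d}u,\,Q_{12}=q_{\mathrm o}u)\,u^2\,du$, and $f_{\hat R,\hat\theta}$ is the image of $f_{\hat{\boldsymbol q}}$ under $(q_{\mathrm d},q_{\mathrm o})\mapsto(R,\theta)$. Here $\operatorname{erfc}$ is the complementary error function. *)

(* Defs.v *)
From mathcomp Require Import all_boot all_order all_algebra.
From mathcomp Require Import complex.
From mathcomp Require Import all_classical all_reals all_analysis.

Set Implicit Arguments.
Unset Strict Implicit.
Unset Printing Implicit Defensive.

Import Order.TTheory GRing.Theory Num.Theory.
Import numFieldNormedType.Exports.

Local Open Scope classical_set_scope.
Local Open Scope ring_scope.

Notation leb1 R := (@lebesgue_measure R) (only parsing).
Notation leb2 R := (@lebesgue_measure R \x @lebesgue_measure R)%E
  (only parsing).

Definition dot2 (R : realType) (k r : R * R) : R := k.1 * r.1 + k.2 * r.2.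

(* Written out because the library norm on [R * R] is the sup norm. *)
Definition norm2 (R : realType) (k : R * R) : R := Num.sqrt (dot2 k k).

Definition basis2 (R : realType) (i : 'I_2) : R * R :=
  if i == ord0 then (1, 0) else (0, 1).

Definition vec3 (R : realType) (x y z : R) : 'cV[R]_3 :=
  \col_(i < 3) [:: x; y; z]`_i.

Definition bilin (R : realType) (n : nat) (u : 'cV[R]_n) (C : 'M[R]_n)
    (v : 'cV[R]_n) : R :=
  (u^T *m C *m v) ord0 ord0.

Definition posdef (R : realType) (n : nat) (C : 'M[R]_n) : Prop :=
  C^T = C /\
  forall v : 'cV[R]_n, v != 0 -> 0 < bilin v C v.

Definition erfc (R : realType) (x : R) : R :=
  2 / Num.sqrt pi * Rintegral (leb1 R) `[x, +oo[ (fun t => expR (- t ^+ 2)).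

Section random_field.
Context (d : measure_display) (T : measurableType d) (R : realType)
  (P : probability T R).

(* [normal_prob] with standard deviation 0 is not a point mass, so the
   degenerate case, which Gaussian fields include, is added explicitly. *)
Definition gaussian_rv (Y : T -> R) : Prop :=
  exists m sigma : R, 0 <= sigma /\
    forall A : set R, measurable A ->
      P (Y @^-1` A) =
      if sigma == 0 then dirac m A else normal_prob m sigma A.

Definition gaussian_field (D : set (R * R)) (X : R * R -> {RV P >-> R}) : Prop :=
  forall (n : nat) (s : 'I_n -> R * R) (a : 'I_n -> R),
    (forall i, D (s i)) ->
    gaussian_rv (fun w => \sum_(i < n) a i * X (s i) w).

(* [c] is defined for all lags, since the spectral density integrates it over
   the whole plane even when [D] is bounded. *)
Definition covariance_function (c : R * R -> R) : Prop :=
  (forall r, c (- r) = c r) /\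
  forall (n : nat) (s : 'I_n -> R * R) (a : 'I_n -> R),
    0 <= \sum_(i < n) \sum_(j < n) a i * a j * c (s i - s j).

Definition wide_sense_stationary (D : set (R * R)) (X : R * R -> {RV P >-> R})
    (m : R) (c : R * R -> R) : Prop :=
  [/\ covariance_function c,
      forall s, D s -> (X s : T -> R) \in Lfun P 2%:E,
      forall s, D s -> 'E_P[X s]%E = m%:E
    & forall s t, D s -> D t -> covariance P (X s) (X t) = (c (s - t))%:E].

Definition ms_partial (X : R * R -> {RV P >-> R}) (i : 'I_2) (s : R * R)
    (Y : T -> R) : Prop :=
  'E_P[(fun w => ((X (s + h *: basis2 R i) w - X s w) / h - Y w) ^+ 2)%R]%E
    @[h --> (0 : R)^'] --> 0%E.

Definition ms_gradient (D : set (R * R)) (X : R * R -> {RV P >-> R})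
    (dX : 'I_2 -> R * R -> {RV P >-> R}) : Prop :=
  forall (i : 'I_2) (s : R * R), D s -> ms_partial X i s (dX i s).

Definition short_ranged (c : R * R -> R) : Prop :=
  (leb2 R).-integrable setT (EFin \o c).

Definition spectral_density (c : R * R -> R) (k : R * R) : R[i] :=
  Complex (fine (\int[leb2 R]_r (cos (dot2 k r) * c r)%:E))
          (- fine (\int[leb2 R]_r (sin (dot2 k r) * c r)%:E)).

(* In the order of [R[i]], [z <= x] with [x] real entails that [z] is real. *)
Definition spectral_decay (c : R * R -> R) : Prop :=
  exists eps Cinf M : R, [/\ 0 < eps, 0 < Cinf, 0 < M
    & forall k : R * R, M <= norm2 k ->
        spectral_density c k <= (Cinf / (norm2 k `^ (3 + eps)))%:C%C].

Section gradient_tensor.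
Context (dX : 'I_2 -> R * R -> {RV P >-> R}).

Definition grad_tensor (i j : 'I_2) (s : R * R) : T -> R :=
  fun w => dX i s w * dX j s w.

Definition mean_grad_tensor (s : R * R) : 'cV[R]_3 :=
  vec3 (fine 'E_P[(grad_tensor 0 0 s)%R]%E)
       (fine 'E_P[(grad_tensor 1 1 s)%R]%E)
       (fine 'E_P[(grad_tensor 0 1 s)%R]%E).

Context (N : nat) (s : 'I_N -> R * R).

Definition sample_grad_tensor (i j : 'I_2) : T -> R :=
  fun w => N%:R^-1 * \sum_(k < N) grad_tensor i j (s k) w.

Definition sample_grad_vec (w : T) : 'cV[R]_3 :=
  vec3 (sample_grad_tensor 0 0 w)
       (sample_grad_tensor 1 1 w)
       (sample_grad_tensor 0 1 w).

Definition sample_grad_cov : 'M[R]_3 :=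
  \matrix_(a < 3, b < 3)
    fine (covariance P (fun w => sample_grad_vec w a ord0)
                       (fun w => sample_grad_vec w b ord0)).

End gradient_tensor.
End random_field.

Definition gaussian_pdf3 (R : realType) (m : 'cV[R]_3) (C : 'M[R]_3)
    (x : 'cV[R]_3) : R :=
  (2 * pi) `^ (- (3 / 2)) * (\det C) `^ (- (1 / 2)) *
  expR (- (1 / 2) * bilin (x - m) (invmx C) (x - m)).

(* Density of the ratios [(Q22 / Q11, Q12 / Q11)] induced by the Gaussian law
   of [(Q11, Q22, Q12)]; the eliminated variable [u] stands for [Q11 >= 0] and
   [u ^+ 2] is the Jacobian.  It has mass less than 1, because the Gaussian
   law charges [Q11 < 0]. *)
Definition asymp_ratio_density (R : realType) (Q : 'cV[R]_3) (C : 'M[R]_3)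
    (q : R * R) : \bar R :=
  (\int[leb1 R]_(u in `[0%R, +oo[)
    (gaussian_pdf3 Q C (vec3 u (q.1 * u) (q.2 * u)) * u ^+ 2)%:E)%E.

Definition ratios_of_aniso (R : realType) (p : R * R) : R * R :=
  let t := tan p.2 in
  ((1 + p.1 ^+ 2 * t ^+ 2) / (p.1 ^+ 2 + t ^+ 2),
   t * (p.1 ^+ 2 - 1) / (p.1 ^+ 2 + t ^+ 2)).

(* [p = (R, theta)] solves the equations for the ratios [q]. *)
Definition aniso_statistics (R : realType) (q p : R * R) : Prop :=
  [/\ 0 <= p.1, - (pi / 4) <= p.2 < pi / 4,
      p.1 ^+ 2 + tan p.2 ^+ 2 != 0 & q = ratios_of_aniso p].

(* Image of the law of the ratios under [q |-> (R, theta)].  The preimage of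
   [A] is taken along the relation [aniso_statistics], which is the graph of a
   function except at the single point [q = (1, 0)]. *)
Definition asymp_aniso_law (R : realType) (Q : 'cV[R]_3) (C : 'M[R]_3)
    (A : set (R * R)) : \bar R :=
  (\int[leb2 R]_(q in [set q | exists2 p, A p & aniso_statistics q p])
    asymp_ratio_density Q C q)%E.

Definition aniso_range (R : realType) : set (R * R) :=
  [set p | 0 < p.1 /\ - (pi / 4) <= p.2 < pi / 4].

Definition is_asymp_aniso_density (R : realType) (Q : 'cV[R]_3) (C : 'M[R]_3)
    (f : R * R -> R) : Prop :=
  [/\ measurable_fun (@aniso_range R) f,
      forall p, aniso_range p -> 0 <= f p
    & forall A : set (R * R), measurable A -> A `<=` @aniso_range R ->
        asymp_aniso_law Q C A = (\int[leb2 R]_(p in A) (f p)%:E)%E].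

Section closed_form.
Context (R : realType) (N : nat) (Q : 'cV[R]_3) (C : 'M[R]_3).

Definition qprime (q : R * R) : 'cV[R]_3 := vec3 1 q.1 q.2.

Definition z1 (q : R * R) : R :=
  Num.sqrt (bilin (qprime q) (invmx C) (qprime q)).

Definition z2 (q : R * R) : R := - 2 * bilin Q (invmx C) (qprime q).

Definition lambda1 : R := bilin Q (invmx C) Q.

Definition lambda2 : R := (2 * pi) `^ (- (3 / 2)) * (\det C) `^ (- (1 / 2)).

Definition ycoef (q : R * R) : R :=
  z2 q / (2 * Num.sqrt 2 * z1 q) / Num.sqrt N%:R.

Definition lambda1_tilde : R := lambda1 / (2 * N%:R).

Definition ratio_density_formula (q : R * R) : R :=
  lambda2 * expR (- (N%:R * lambda1_tilde)) / (Num.sqrt 2 * z1 q ^+ 3) *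
  (Num.sqrt pi * (2 * ycoef q ^+ 2 * N%:R + 1) * expR (ycoef q ^+ 2 * N%:R) *
     erfc (ycoef q * Num.sqrt N%:R)
   - 2 * ycoef q * Num.sqrt N%:R).

Definition aniso_density_formula (p : R * R) : R :=
  2 * p.1 * `|p.1 ^+ 2 - 1| * ratio_density_formula (ratios_of_aniso p) /
  (p.1 ^+ 2 * cos p.2 ^+ 2 + sin p.2 ^+ 2) ^+ 3.

End closed_form.

(* Main.v *)
Require Import Defs.
From HB Require Import structures.
From mathcomp Require Import all_boot all_order all_algebra.
From mathcomp Require Import all_classical all_reals all_analysis.
From mathcomp Require Import measurable_realfun ring lra.
Import Order.TTheory GRing.Theory Num.Theory.
Import numFieldNormedType.Exports.
Local Open Scope classical_set_scope.
Local Open Scope ring_scope.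

(** The two densities are functions of a vector [Q] and of a positive definite
    matrix [C], so the theorem is a computation about the trivariate Gaussian
    density, in two independent parts.

    Density of the ratios.  On the ray [u |-> u q'], with [q' = (1, q)], the
    Gaussian exponent is a quadratic polynomial in [u] whose leading
    coefficient [z1 ^+ 2] is positive.  Completing the square turns the
    integral that defines [asymp_ratio_density] into a constant times the
    integral over [u >= 0] of [u ^+ 2 * exp (- (k u + w) ^+ 2)], where
    [k = z1 / sqrt 2] and [w = y sqrt N].  That integrand has an explicit
    primitive in terms of the Gaussian function and of its tail integral, which
    is [erfc] up to a factor ([integral_sqr_gauss], [asymp_ratio_densityE]).

    Image under the change of parameters.  With [t = tan theta], the equations
    for the ratios are equivalent, where [theta] is in the open interval
    ]-pi/4, pi/4[ and [R > 0], to
      [q_d = (1 + R ^+ 2 t ^+ 2) / (R ^+ 2 + t ^+ 2)] and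
      [q_o = (1 - q_d) * tan (2 theta) / 2]
    (the double-angle formula for the principal axes of a symmetric 2 x 2
    matrix).  Hence the passage from [(q_d, q_o)] to [(R, theta)] splits into
    two substitutions in one real variable: at fixed [q_d != 1] the second
    equation maps ]-pi/4, pi/4[ onto the real line, and at fixed [theta] the
    first one is decreasing in [R].  Tonelli's theorem exchanges the two
    integrals in between, and the product of the two derivatives is the
    announced Jacobian ([aniso_jacobianE]).  The exceptional sets are the line
    [q_d = 1], the edge [theta = - pi / 4], both null, and the line [R = 1],
    which is contracted to the point [(1, 0)] and on which the Jacobian
    vanishes.

    The integrands carry the indicator of an arbitrary measurable set, so the
    one-variable substitution is proved for measurable functions
    ([ge0_integral_subst]) by identifying two measures.  The set of ratios
    whose parameters lie in a given measurable set is measurable because the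
    map [ratios_of_aniso] has an explicit measurable left inverse away from
    [(1, 0)] ([aniso_of_ratiosK], [measurable_aniso_preimage]). *)

(** * Substitution in one variable for measurable integrands *)

Section density_measure.
Context d (T : measurableType d) (R : realType)
  (mu : {sigma_finite_measure set T -> \bar R}) (f : T -> R).

(** The proofs of nonnegativity and integrability are arguments so that the
    finite measure structure below can be inferred. *)
Definition density_measure of (forall x, 0 <= f x) &
    mu.-integrable setT (EFin \o f) : set T -> \bar R :=
  fun A => (\int[mu]_(x in A) (f x)%:E)%E.

Hypotheses (f0 : forall x, 0 <= f x) (fi : mu.-integrable setT (EFin \o f)).
Local Notation nu := (density_measure f0 fi).

Let nu0 : nu set0 = 0%E. Proof. exact: integral_set0. Qed.

Let nu_ge0 A : (0 <= nu A)%E.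
Proof. by apply: integral_ge0 => x _; rewrite lee_fin. Qed.

Let nu_sigma_additive : semi_sigma_additive nu.
Proof.
move=> A mA tA mUA; rewrite /density_measure integral_bigcup//=; last first.
  exact: integrableS fi.
by apply: is_cvg_ereal_nneg_natsum_cond => n _ _; exact: nu_ge0.
Qed.

HB.instance Definition _ := isMeasure.Build _ _ _ nu nu0 nu_ge0
  nu_sigma_additive.

Let nu_fin : fin_num_fun nu.
Proof.
move=> A mA; apply: integrable_fin_num => //.
exact: integrableS fi.
Qed.

HB.instance Definition _ := Measure_isFinite.Build _ _ _ nu nu_fin.

Lemma density_measure_dominates : nu `<< mu.
Proof.
apply/null_content_dominatesP => A mA muA0; apply: null_set_integral => //.
by apply: measurable_funTS; exact: measurable_int fi.
Qed.

(** [f] is a version of the Radon-Nikodym derivative of its own density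
    measure, for which the formula is known. *)
Lemma integral_density_measure (g : T -> \bar R) :
  measurable_fun setT g -> (forall x, 0 <= g x)%E ->
  (\int[nu]_x g x = \int[mu]_x (g x * (f x)%:E))%E.
Proof.
move=> mg g0.
rewrite -(Radon_Nikodym_SigmaFinite.change_of_variables
  density_measure_dominates g0 measurableT mg).
have RNi := Radon_Nikodym_SigmaFinite.f_integrable density_measure_dominates.
have mf := measurable_int mu fi.
apply: ge0_ae_eq_integral => //.
- by apply: emeasurable_funM => //; exact: measurable_int RNi.
- exact: emeasurable_funM.
- move=> x _; rewrite mule_ge0//.
  exact: (Radon_Nikodym_SigmaFinite.f_ge0 density_measure_dominates).
- by move=> x _; rewrite mule_ge0// lee_fin.
apply: ae_eqe_mul2l; apply: integral_ae_eq => //.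
move=> A _ mA.
by rewrite -(Radon_Nikodym_SigmaFinite.f_integral density_measure_dominates).
Qed.

End density_measure.
Arguments density_measure {d T R mu f}.
Arguments integral_density_measure {d T R mu f}.

Section change_of_variable.
Variable R : realType.
Local Notation mu := (@lebesgue_measure R).
Implicit Types (F f : R -> R) (g : R -> \bar R).

Lemma derive_continuous F f (x : R) :
  is_derive x 1 F (f x) -> {for x, continuous F}.
Proof.
by move=> [dF _]; apply/differentiable_continuous; apply/derivable1_diffP.
Qed.

Lemma derive_gt0_continuous_mono F f (a b : R) :
  (forall x, x \in `[a, b] -> is_derive x 1 F (f x)) ->
  (forall x, x \in `[a, b] -> 0 < f x) ->
  {within `[a, b], continuous F} /\ {in `[a, b] &, {mono F : x y / x <= y}}.
Proof.
move=> dF f_gt0; have wF : {within `[a, b], continuous F}.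
  apply: continuous_in_subspaceT => x; rewrite inE => /dF.
  exact: derive_continuous.
split=> //; apply: le_mono_in; apply: gtr0_derive1_lt_cc => // x xab.
  by have [] := dF _ (subset_itv_oo_cc xab).
have dFx := dF _ (subset_itv_oo_cc xab).
by rewrite derive1E derive_val f_gt0//; exact: subset_itv_oo_cc xab.
Qed.

(** The measure of density [f] on the segment from [a] to [b], transported by
    [F], and Lebesgue measure on the segment from [F a] to [F b] agree on every
    half-line bounded below, by the fundamental theorem of calculus.  Such
    half-lines generate the Borel sets, so the two measures are equal, and then
    so are the integrals of every measurable [g]. *)
Lemma ge0_integral_subst_incr_cc F f g (a b : R) : a < b ->
  (forall x, x \in `[a, b] -> is_derive x 1 F (f x)) ->
  (forall x, x \in `[a, b] -> {for x, continuous f}) ->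
  (forall x, x \in `[a, b] -> 0 < f x) ->
  measurable_fun setT g -> (forall x, 0 <= g x)%E ->
  (\int[mu]_(y in `[F a, F b]) g y =
   \int[mu]_(x in `[a, b]) (g (F x) * (f x)%:E))%E.
Proof.
move=> ab dF cf f_gt0 mg g0.
have cF x : x \in `[a, b] -> {for x, continuous F}.
  by move=> /dF; exact: derive_continuous.
have wf : {within `[a, b], continuous f}.
  by apply: continuous_in_subspaceT => x; rewrite inE => /cf.
have [wF leF] := derive_gt0_continuous_mono _ _ _ _ dF f_gt0.
have aab : a \in `[a, b] by rewrite in_itv/= lexx ltW.
have bab : b \in `[a, b] by rewrite in_itv/= lexx ltW.
have FTC x : x \in `[a, b] ->
    (\int[mu]_(t in `[x, b]) (f t)%:E = (F b - F x)%:E)%E.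
  move=> /[dup] xab; rewrite in_itv/= => /andP[ax xb].
  have [xltb|] := ltP x b; last first.
    move=> bx; have -> : x = b by apply/le_anti; rewrite xb bx.
    by rewrite set_itv1 integral_set1 subrr.
  have sub : `[x, b] `<=` `[a, b] by apply: subset_itvr; rewrite bnd_simp.
  rewrite EFinB; apply: continuous_FTC2 => //.
  - exact: continuous_subspaceW wf.
  - split.
    + by move=> z zxb; have [] := dF _ (sub _ (subset_itv_oo_cc zxb)).
    + by apply: cvg_at_right_filter; exact: cF.
    + apply: cvg_at_left_filter; apply: cF.
      by rewrite in_itv/= lexx andbT ltW.
  - move=> z zxb; have dFz := dF _ (sub _ (subset_itv_oo_cc zxb)).
    by rewrite derive1E derive_val.
pose fab := f \_ `[a, b].
pose Fab := F \_ `[a, b].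
have fab0 x : 0 <= fab x.
  by rewrite /fab patchE; case: ifPn => // /set_mem /f_gt0/ltW.
have fabi : mu.-integrable setT (EFin \o fab).
  rewrite /fab -restrict_EFin; apply/integrable_restrict => //=.
  rewrite setTI; apply: continuous_compact_integrable => //.
  exact: segment_compact.
have mFab : measurable_fun setT (Fab : measurableTypeR R -> measurableTypeR R).
  apply/(measurable_restrictT F) => //.
  exact: subspace_continuous_measurable_fun.
pose nu := @density_measure _ (measurableTypeR R) R mu fab fab0 fabi.
pose I := `[F a, F b]%classic.
have mI : measurable I by exact: measurable_itv.
pose m1 : {measure set (measurableTypeR R) -> \bar R} := mrestr mu mI.
pose pushF : {measure set (measurableTypeR R) -> \bar R} :=
  pushforward nu (Fab : measurableTypeR R -> measurableTypeR R).
pose m2 := pushF mFab.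
have m2E B : m2 B = (\int[mu]_(x in `[a, b] `&` F @^-1` B) (f x)%:E)%E.
  rewrite /m2/= /pushforward /density_measure.
  rewrite [RHS]integral_mkcond [LHS]integral_mkcond; apply: eq_integral => x _.
  rewrite !patchE /fab /Fab patchE !in_setI.
  have [xab|xab] := boolP (x \in `[a, b]%classic); last by rewrite /= if_same.
  rewrite /=; congr (if _ then _ else _).
  by apply/idP/idP; rewrite !inE/= /Fab patchE xab.
(* [m1] is Lebesgue measure on [I], [m2] the transported density measure. *)
have m12 (B : set (measurableTypeR R)) : measurable B -> m1 B = m2 B.
  move: B; apply: (@measure_unique _ _ (measurableTypeR R) (@RGenCInfty.G R)
    (fun n => `[- n%:R, +oo[%classic) _ _ _ _ m1 m2).
  - exact: RGenCInfty.measurableE.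
  - move=> _ _ [x ->] [y ->]; exists (Num.max x y).
    by apply/seteqP; split => z /=; rewrite !in_itv/= !andbT ge_max => /andP.
  - by move=> n; eexists.
  - apply/seteqP; split => // x _.
    exists (Num.trunc `|x|).+1 => //=.
    rewrite in_itv/= andbT lerNl.
    by rewrite (le_trans (ler_norm _))// normrN ltW// truncnS_gt.
  - move=> _ [x ->]; rewrite m2E /m1/= /mrestr.
    have [xFa|Fax] := leP x (F a).
      rewrite (_ : _ `&` I = I); last first.
        apply/setIidr => y; rewrite /I/= !in_itv/= andbT => /andP[Fay _].
        exact: le_trans Fay.
      rewrite (_ : _ `&` _ = `[a, b]%classic); last first.
        apply/setIidl => y yab /=; rewrite in_itv/= andbT (le_trans xFa)//.
        by rewrite leF//; move: yab; rewrite /= in_itv/= => /andP[].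
      by rewrite FTC// /I lebesgue_measure_itv/= lte_fin (leW_mono_in leF)// ab.
    have [xFb|Fbx] := leP x (F b); last first.
      rewrite (_ : _ `&` I = set0); last first.
        rewrite -subset0 => y [/=]; rewrite in_itv/= andbT => xy.
        rewrite /I/= in_itv/= => /andP[_ yFb].
        by have := lt_le_trans Fbx (le_trans xy yFb); rewrite ltxx.
      rewrite (_ : _ `&` _ = set0); last first.
        rewrite -subset0 => y [/=] yab; rewrite in_itv/= andbT => xFy.
        have : F y <= F b by rewrite leF//; move: yab; rewrite in_itv/= => /andP[].
        by move=> /(le_trans xFy); rewrite leNgt Fbx.
      by rewrite measure0 integral_set0.
    (* The half-line cuts the image at [x = F c], its preimage at [c]. *)
    have [|c cab Fc] := @IVT R F a b x (ltW ab) wF.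
      by rewrite ge_min le_max (ltW Fax) xFb orbT.
    rewrite (_ : _ `&` I = `[x, F b]%classic); last first.
      apply/seteqP; split => y; rewrite /I/= !in_itv/= andbT.
        by move=> [-> /andP[]].
      by move=> /andP[xy ->]; rewrite xy (le_trans (ltW Fax)).
    rewrite (_ : _ `&` _ = `[c, b]%classic); last first.
      apply/seteqP; split => y /=.
        by move=> [yab]; move: (yab); rewrite !in_itv/= andbT -Fc leF// => /andP[_ ->] ->.
      rewrite !in_itv/= andbT => /andP[cy yb].
      have yab : y \in `[a, b].
        by rewrite in_itv/= yb andbT (le_trans _ cy)//; move: cab; rewrite in_itv/= => /andP[].
      by move: (yab); rewrite in_itv/= => ->; rewrite -Fc leF.
    rewrite FTC// Fc lebesgue_measure_itv/= lte_fin.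
    have [//|bx] := ltP; have -> : x = F b by apply/le_anti; rewrite xFb bx.
    by rewrite subrr.
  - move=> n; have : (mu I < +oo)%E; last first.
      apply: le_lt_trans; apply: le_measure; rewrite ?inE.
      - by apply: measurableI => //; exact: measurable_itv.
      - exact: mI.
      - exact: subIsetr.
    by rewrite /I lebesgue_measure_itv/=; case: ifP; rewrite ?ltry.
transitivity (\int[m1]_(y in I) g y)%E.
  apply: eq_measure_integral => A mA AI; rewrite /m1/= /mrestr.
  by congr (mu _); apply/esym/setIidl.
transitivity (\int[m2]_(y in I) g y)%E.
  by apply: eq_measure_integral => A mA _; exact: m12.
rewrite ge0_integral_pushforward//; last exact: measurable_funTS.
have mFI : measurable (Fab @^-1` I).
  by rewrite -[X in measurable X]setTI; exact: (mFab measurableT I mI).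
have mgF : measurable_fun setT ((g \o Fab) \_ (Fab @^-1` I)).
  apply/(measurable_restrictT (g \o Fab)) => //.
  by apply: measurable_funTS; exact: measurableT_comp.
rewrite [LHS]integral_mkcond integral_density_measure; last 2 first.
- exact: mgF.
- by move=> x; apply: erestrict_ge0 => y _; exact: g0.
rewrite [RHS]integral_mkcond; apply: eq_integral => x _.
rewrite /fab [in RHS]patchE [X in (_ * X%:E)%E]patchE.
have [|_] := boolP (x \in _); last by rewrite mule0.
move=> /[dup] xab; rewrite inE/= => xab'.
rewrite patchE mem_set ?/= /Fab/= patchE xab//.
by rewrite /I/= in_itv/= !leF//; move: xab'; rewrite in_itv/=.
Qed.

(** In the applications the interval is open or unbounded and [F] or its
    derivative need not extend to the ends, so the formula on segments is passed
    to the limit along an increasing sequence, by monotone convergence. *)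
Section exhaustion.
Variables (a_ b_ : nat -> R).
Hypotheses (ab_ : forall n, a_ n < b_ n) (na : nonincreasing_seq a_)
  (nb : nondecreasing_seq b_).
Let U : set R := \bigcup_n `[a_ n, b_ n]%classic.

Lemma ge0_integral_subst_incr F f g :
  (forall x, U x -> is_derive x 1 F (f x)) ->
  (forall x, U x -> {for x, continuous f}) ->
  (forall x, U x -> 0 < f x) ->
  measurable_fun setT g -> (forall x, 0 <= g x)%E ->
  (forall y, ~ (F @` U) y -> g y = 0%E) ->
  (\int[mu]_y g y = \int[mu]_(x in U) (g (F x) * (f x)%:E))%E.
Proof.
move=> dF cf f_gt0 mg g0 gU.
have abU n x : x \in `[a_ n, b_ n] -> U x by move=> xn; exists n.
have ndab : nondecreasing_seq (fun n => `[a_ n, b_ n]%classic).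
  move=> m n mn; rewrite subsetEset; apply: subset_itv; rewrite bnd_simp.
    exact: na.
  exact: nb.
have cF x : U x -> {for x, continuous F}.
  by move=> /dF; exact: derive_continuous.
have imF n : F @` `[a_ n, b_ n] = `[F (a_ n), F (b_ n)]%classic.
  have [wF leF] := derive_gt0_continuous_mono F f (a_ n) (b_ n)
    (fun x xab => dF x (abU n x xab)) (fun x xab => f_gt0 x (abU n x xab)).
  have aab : a_ n \in `[a_ n, b_ n] by rewrite in_itv/= lexx ltW.
  have bab : b_ n \in `[a_ n, b_ n] by rewrite in_itv/= lexx ltW.
  apply/seteqP; split => [_ [x xab <-]|y].
    by rewrite /= in_itv/= !leF//; move: xab; rewrite /= in_itv.
  rewrite /= in_itv/= => /andP[Fay yFb].
  have [|c cab <-] := @IVT R F _ _ y (ltW (ab_ n)) wF; last by exists c.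
  by rewrite ge_min le_max Fay yFb orbT.
have UF : F @` U = \bigcup_n `[F (a_ n), F (b_ n)]%classic.
  by rewrite /U image_bigcup; apply: eq_bigcup => // n _; exact: imF.
have mFU : measurable (F @` U).
  by rewrite UF; apply: bigcup_measurable => n _; exact: measurable_itv.
have mU : measurable U.
  by apply: bigcup_measurable => n _; exact: measurable_itv.
transitivity (\int[mu]_(y in F @` U) g y)%E.
  rewrite [RHS]integral_mkcond; apply: eq_integral => y _; rewrite patchE.
  by have [//|yU] := boolP (y \in _); apply: gU => /mem_set yFU; rewrite yFU in yU.
have ndF : nondecreasing_seq (fun n => `[F (a_ n), F (b_ n)]%classic).
  move=> m n mn; rewrite subsetEset -!imF; apply: image_subset.
  by rewrite -subsetEset; exact: ndab.
have mgF n : measurable_fun `[a_ n, b_ n] (fun x => g (F x) * (f x)%:E)%E.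
  apply: emeasurable_funM.
    apply: (measurableT_comp mg); apply: subspace_continuous_measurable_fun => //.
    by apply: continuous_in_subspaceT => x; rewrite inE => /(abU n)/cF.
  apply/measurable_EFinP; apply: subspace_continuous_measurable_fun => //.
  by apply: continuous_in_subspaceT => x; rewrite inE => /(abU n)/cf.
have cvgl : (\int[mu]_(y in `[F (a_ n), F (b_ n)]) g y @[n --> \oo] -->
    \int[mu]_(y in F @` U) g y)%E.
  rewrite UF; apply: ge0_nondecreasing_set_cvg_integral => //.
  by move=> n; exact: measurable_funTS.
have cvgr : (\int[mu]_(x in `[a_ n, b_ n]) (g (F x) * (f x)%:E) @[n --> \oo] -->
    \int[mu]_(x in U) (g (F x) * (f x)%:E))%E.
  apply: ge0_nondecreasing_set_cvg_integral => //.
  by move=> n x /(abU n)/f_gt0 fx; rewrite mule_ge0// lee_fin ltW.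
have /cvg_lim := cvgl; move=> <- //; apply: cvg_lim => //; apply: cvg_trans cvgr.
apply: near_eq_cvg; near=> n; apply/esym.
apply: ge0_integral_subst_incr_cc => // x /(abU n).
- exact: dF.
- exact: cf.
- exact: f_gt0.
Unshelve. all: end_near. Qed.

Lemma ge0_integralN g : measurable_fun setT g -> (forall x, 0 <= g x)%E ->
  (\int[mu]_y g y = \int[mu]_y g (- y)%R)%E.
Proof.
move=> mg g0.
transitivity (\int[pushforward mu (-%R : _ -> measurableTypeR R)]_y g y)%E.
  by apply: eq_measure_integral => A mA _; exact/esym/lebesgue_measureN.
exact: ge0_integral_pushforward.
Qed.

(** The image of [F] enters through the vanishing of [g] outside of it, which
    spares its description as an interval; a negative derivative is reduced to
    a positive one by the reflection of the target. *)
Lemma ge0_integral_subst F f g :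
  (forall x, U x -> is_derive x 1 F (f x)) ->
  (forall x, U x -> {for x, continuous f}) ->
  (forall x, U x -> 0 < f x) \/ (forall x, U x -> f x < 0) ->
  measurable_fun setT g -> (forall x, 0 <= g x)%E ->
  (forall y, ~ (F @` U) y -> g y = 0%E) ->
  (\int[mu]_y g y = \int[mu]_(x in U) (g (F x) * `|f x|%:E))%E.
Proof.
move=> dF cf [f_gt0|f_lt0] mg g0 gU.
  rewrite (ge0_integral_subst_incr F f)//; apply: eq_integral => x.
  by rewrite inE => /f_gt0 fx; rewrite gtr0_norm.
have dNF x : U x -> is_derive x 1 (\- F) (- f x) by move=> /dF dFx; exact: is_deriveN.
rewrite ge0_integralN// (ge0_integral_subst_incr (\- F) (\- f) _ dNF)//.
- by apply: eq_integral => x; rewrite inE => /f_lt0 fx; rewrite ltr0_norm// opprK.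
- by move=> x /cf cfx; exact: continuousN.
- by move=> x /f_lt0; rewrite oppr_gt0.
- exact: measurableT_comp.
- by move=> y Uy; apply: gU => -[x Ux Fx]; apply: Uy; exists x => //=; rewrite Fx opprK.
Qed.

End exhaustion.
End change_of_variable.

Section exhaustions.
Context {R : realType}.

(* In both exhaustions the index is offset by 2 so that every segment is
   nondegenerate. *)
Lemma itv_sym_bigcup (c : R) : 0 < c -> `]- c, c[%classic =
  \bigcup_n `[- (c * (1 - n.+2%:R^-1)), c * (1 - n.+2%:R^-1)]%classic.
Proof.
move=> c0; apply/seteqP; split => x.
  rewrite /= in_itv/= -ltr_norml => xc.
  have d0 : 0 < c - `|x| by rewrite subr_gt0.
  exists (Num.trunc (c / (c - `|x|))) => //=.
  rewrite in_itv/= -ler_norml.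
  set m := (_.+2)%:R; have m0 : 0 < m :> R by rewrite ltr0n.
  have : c / (c - `|x|) <= m.
    rewrite ltW// /m -addn1 natrD ltr_pwDr//; last exact/ltW/truncnS_gt.
  rewrite ler_pdivrMr// => cm.
  rewrite mulrBr mulr1 lerBrDr -lerBrDl ler_pdivrMr//; lra.
move=> [n _] /=; rewrite !in_itv/= -ler_norml -ltr_norml => /le_lt_trans; apply.
by rewrite gtr_pMr// gtrBl invr_gt0 ltr0n.
Qed.

Lemma itv_pos_bigcup : `]0%R, +oo[%classic =
  \bigcup_n `[n.+2%:R^-1, n.+2%:R]%classic :> set R.
Proof.
apply/seteqP; split => x; last first.
  move=> [n _] /=; rewrite !in_itv/= andbT => /andP[+ _].
  by apply: lt_le_trans; rewrite invr_gt0 ltr0n.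
rewrite /= in_itv/= andbT => x0.
have xV0 : 0 < x^-1 by rewrite invr_gt0.
exists (Num.trunc (x + x^-1)) => //=; rewrite in_itv/=.
set m := (_.+2)%:R; have m0 : 0 < m :> R by rewrite ltr0n.
have xm : x + x^-1 <= m.
  by rewrite ltW// /m -addn1 natrD ltr_pwDr//; exact/ltW/truncnS_gt.
apply/andP; split; last lra.
by rewrite -[leRHS]invrK lef_pV2 ?posrE//; lra.
Qed.

End exhaustions.

Lemma eq_integral_except {R : realType} (r : R) (f g : R -> \bar R) :
  measurable_fun setT f -> (forall x, x <> r -> f x = g x) ->
  (\int[@lebesgue_measure R]_x f x = \int[@lebesgue_measure R]_x g x)%E.
Proof.
move=> mf fg.
have mTr : measurable (setT `\ r : set R) by apply: measurableD => //; exact: measurable_set1.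
have fgr : {in setT `\ r, f =1 g} by move=> x; rewrite inE => -[_]; exact: fg.
rewrite -(@integral_setD1 _ f r)//; last exact: measurable_funTS.
rewrite -(@integral_setD1 _ g r)//; first exact: eq_integral.
by apply: (eq_measurable_fun f) => //; exact: measurable_funTS.
Qed.


(** * Gaussian moments on a half-line *)

Section gauss_tail.
Variable R : realType.
Local Notation mu := (@lebesgue_measure R).

Definition gauss_tail (x : R) : R := Rintegral mu `[x, +oo[ (@gauss_fun R).

Lemma erfcE (x : R) : erfc x = 2 / Num.sqrt pi * gauss_tail x.
Proof. by []. Qed.

(** The tail is the constant total integral minus the integral over the
    complementary half-line, to which the fundamental theorem of calculus
    applies. *)
Lemma is_derive_gauss_tail (x : R) : is_derive x 1 gauss_tail (- gauss_fun x).
Proof.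
pose Phi (y : R) : R := Rintegral mu `]-oo, y] (@gauss_fun R).
have gi (D : set R) : measurable D -> mu.-integrable D (EFin \o @gauss_fun R).
  by move=> mD; exact: integrableS (integrableT_gauss).
have -> : gauss_tail = (fun y => Rintegral mu setT (@gauss_fun R) - Phi y).
  apply/funext => y; rewrite -set_itvNyy Rintegral_itvB//; last first.
    by rewrite set_itvNyy; exact: gi.
  by rewrite Rintegral_itv_obnd_cbnd//; exact: gi.
have [dPhi PhiE] := @continuous_FTC1 R (@gauss_fun R) -oo%O x (x + 1)
  (ltr_pwDr ltr01 (lexx x)) (gi _ (measurable_itv _)) (ltNyr x)
  (@continuous_gauss_fun R x).
have dP : is_derive x 1 Phi (gauss_fun x) by apply: DeriveDef; rewrite -?derive1E.
rewrite -[X in is_derive _ _ _ X]add0r.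
exact: is_deriveB.
Qed.

Lemma gauss_tail_ge0 (x : R) : 0 <= gauss_tail x.
Proof. by apply: Rintegral_ge0 => y _; exact: gauss_fun_ge0. Qed.

Lemma is_derive_gauss_fun (x : R) :
  is_derive x 1 (@gauss_fun R) (- (2 * x) * gauss_fun x).
Proof.
have dsq : is_derive x 1 (- (@id R) ^+ 2) (- (2 * x)).
  by apply: is_derive_eq; rewrite /= expr1 scaler1.
have := @is_derive1_comp R expR (- (@id R) ^+ 2) x _ _ (is_derive_expR _) dsq.
by rewrite mulrC.
Qed.

(** From [1 + x ^+ 2 <= exp (x ^+ 2)] the function is below [1 / x]. *)
Lemma cvg_id_gauss : x * gauss_fun x @[x --> +oo] --> (0 : R).
Proof.
apply: (@squeeze_cvgr _ _ _ _ (fun=> 0) (fun x => x^-1)).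
- near=> x; have x0 : 0 < x by near: x; exact: nbhs_pinfty_gt.
  rewrite mulr_ge0 ?gauss_fun_ge0 ?(ltW x0)//=.
  rewrite /gauss_fun expRN ler_pdivrMr ?expR_gt0//.
  rewrite -ler_pdivrMl ?invr_gt0// invrK.
  apply: le_trans (expR_ge1Dx _); rewrite expr2; lra.
- exact: cvg_cst.
- have /(@gtr0_cvgV0 R R (+oo)%R _ id) [_] : \forall x \near +oo%R, 0 < x :> R.
    exact: nbhs_pinfty_gt.
  by apply; exact: cvg_id.
Unshelve. all: end_near. Qed.

Lemma integral_itvcy_derive (f F : R -> R) (a l : R) :
  (forall x : R, is_derive x 1 F (f x)) -> continuous f ->
  (forall x, a <= x -> 0 <= f x) -> F x @[x --> +oo] --> l ->
  (\int[mu]_(x in `[a, +oo[) (f x)%:E = (l - F a)%:E)%E.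
Proof.
move=> dF cf f0 Fl; rewrite EFinB; apply: ge0_continuous_FTC2y.
- exact: f0.
- by apply: continuous_subspaceT => x; exact: cf.
- exact: Fl.
- by move=> x _; have [] := dF x.
- apply: cvg_at_right_filter; apply/differentiable_continuous.
  by apply/derivable1_diffP; have [] := dF a.
- by move=> x _; rewrite derive1E; have dFx := dF x; rewrite derive_val.
Qed.

(** Beyond 1 the Gaussian function is below [t * exp (- t ^+ 2)], whose
    primitive is elementary. *)
Lemma gauss_tail_le (x : R) : 1 <= x -> gauss_tail x <= gauss_fun x / 2.
Proof.
move=> x1.
have int_id : (\int[mu]_(t in `[x, +oo[) (t * gauss_fun t)%:E =
    (gauss_fun x / 2)%:E)%E.
  have dF (t : R) :
      is_derive t 1 (fun t => - 2^-1 * gauss_fun t) (t * gauss_fun t).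
    apply: (is_derive_eq (is_deriveZ (- 2^-1) (is_derive_gauss_fun t))).
    by rewrite /GRing.scale/=; field.
  rewrite (integral_itvcy_derive _ _ _ 0 dF).
  - by congr EFin; lra.
  - move=> t; apply: cvgM; first exact: cvg_id.
    exact: continuous_gauss_fun.
  - by move=> t xt; rewrite mulr_ge0 ?gauss_fun_ge0//; lra.
  - by rewrite -[X in _ --> X](mulr0 (- 2^-1)); apply: cvgMr; exact: cvg_gauss_fun.
rewrite -lee_fin -int_id /gauss_tail /Rintegral fineK; last first.
  apply: integrable_fin_num => //.
  by apply: integrableS (integrableT_gauss).
apply: ge0_le_integral => //.
- by move=> t _; rewrite lee_fin gauss_fun_ge0.
- by apply/measurable_EFinP; apply: measurable_funTS; exact: measurable_gauss_fun.
- apply/measurable_EFinP; apply: measurable_funTS.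
  by apply: measurable_funM => //; exact: measurable_gauss_fun.
- move=> t; rewrite /= in_itv/= andbT => xt; rewrite lee_fin.
  by rewrite ler_peMl ?gauss_fun_ge0// (le_trans x1).
Qed.

Lemma cvg_gauss_tail : gauss_tail x @[x --> +oo] --> (0 : R).
Proof.
apply: (@squeeze_cvgr _ _ _ _ (fun=> 0) (fun x => gauss_fun x / 2)).
- near=> x; rewrite gauss_tail_ge0/=; apply: gauss_tail_le.
  by near: x; exact: nbhs_pinfty_ge.
- exact: cvg_cst.
- rewrite -[X in _ --> X](mul0r 2^-1); apply: cvgMl; exact: cvg_gauss_fun.
Unshelve. all: end_near. Qed.

(** Primitive of [(x - w) ^+ 2 * exp (- x ^+ 2)] that vanishes at infinity,
    found by expanding the square and integrating by parts. *)
Definition gauss_moment_primitive (w x : R) : R :=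
  (w - x / 2) * gauss_fun x - (w ^+ 2 + 2^-1) * gauss_tail x.

Lemma is_derive_gauss_moment_primitive (w x : R) :
  is_derive x 1 (gauss_moment_primitive w) ((x - w) ^+ 2 * gauss_fun x).
Proof.
have dlin : is_derive x 1 (fun y : R => w - y / 2) (- 2^-1).
  rewrite (_ : (fun y => _) = cst w - 2^-1 *: id); last first.
    by apply/funext => y; rewrite [y / 2]mulrC.
  apply: (is_derive_eq (is_deriveB (is_derive_cst w x 1) (is_deriveZ 2^-1 (is_derive_id x 1)))).
  by rewrite sub0r [_ *: _]mulr1.
have dM := is_deriveM dlin (is_derive_gauss_fun x).
have dT := is_deriveZ (w ^+ 2 + 2^-1) (is_derive_gauss_tail x).
apply: (is_derive_eq (is_deriveB dM dT)).
by rewrite /GRing.scale/=; field.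
Qed.

Lemma cvg_gauss_moment_primitive (w : R) :
  gauss_moment_primitive w x @[x --> +oo] --> (0 : R).
Proof.
rewrite /gauss_moment_primitive.
have -> : (fun x : R => (w - x / 2) * gauss_fun x - (w ^+ 2 + 2^-1) * gauss_tail x) =
  (fun x => w * gauss_fun x - 2^-1 * (x * gauss_fun x) - (w ^+ 2 + 2^-1) * gauss_tail x).
  by apply/funext => x; field.
rewrite [X in _ --> X](_ : _ = w * 0 - 2^-1 * 0 - (w ^+ 2 + 2^-1) * 0); last by rewrite !mulr0 !subr0.
apply: cvgB; first apply: cvgB; apply: cvgMr.
- exact: cvg_gauss_fun.
- exact: cvg_id_gauss.
- exact: cvg_gauss_tail.
Qed.

Lemma integral_sqr_gauss (k w : R) : 0 < k ->
  (\int[mu]_(u in `[0%R, +oo[) (u ^+ 2 * gauss_fun (k * u + w))%:E =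
   (k ^- 3 * ((w ^+ 2 + 2^-1) * gauss_tail w - w / 2 * gauss_fun w))%:E)%E.
Proof.
move=> k0; have kn0 : k != 0 by rewrite gt_eqF.
have dlin (u : R) : is_derive u 1 (fun u : R => k * u + w) k.
  apply: (is_derive_eq (is_deriveD (is_deriveZ k (is_derive_id u 1)) (is_derive_cst w u 1))).
  by rewrite addr0 [_ *: _]mulr1.
have dF (u : R) : is_derive u 1
    (fun u => k ^- 3 * gauss_moment_primitive w (k * u + w))
    (u ^+ 2 * gauss_fun (k * u + w)).
  apply: (is_derive_eq (is_deriveZ (k ^- 3) (@is_derive1_comp R (gauss_moment_primitive w) _ u _ _
    (is_derive_gauss_moment_primitive w _) (dlin u)))).
  rewrite /GRing.scale/=; field.
  exact: kn0.
rewrite (integral_itvcy_derive _ _ _ 0 dF).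
- congr EFin; rewrite mulr0 !add0r /gauss_moment_primitive; field.
  exact: kn0.
- move=> u; apply: cvgM; first exact: exprn_continuous.
  apply: (@continuous_comp _ _ _ (fun u : R => k * u + w)).
    by apply: cvgD; [exact: cvgMr|exact: cvg_cst].
  exact: continuous_gauss_fun.
- by move=> u _; rewrite mulr_ge0 ?gauss_fun_ge0// sqr_ge0.
- rewrite -[X in _ --> X](mulr0 (k ^- 3)); apply: cvgMr.
  apply: (cvg_comp (fun u : R => k * u + w)); last exact: cvg_gauss_moment_primitive.
  apply/cvgryPge => A; near=> u.
  rewrite -lerBlDr mulrC -ler_pdivrMr//.
Unshelve. all: end_near. Qed.

Lemma measurable_gauss_tail : measurable_fun setT gauss_tail.
Proof.
apply: continuous_measurable_fun => x.
by apply/differentiable_continuous/derivable1_diffP; have [] := is_derive_gauss_tail x.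
Qed.

End gauss_tail.

(** * Measurability of the elementary functions involved *)

Section measurable_fun_real.
Context d (T : measurableType d) (R : realType).

(** The inverse is continuous away from 0 and takes the value 0 there. *)
Lemma measurable_inv : measurable_fun setT (@GRing.inv R).
Proof.
have -> : @GRing.inv R = (fun x => if x == 0 then 0 else x^-1).
  by apply/funext => x; case: eqP => // ->; rewrite invr0.
apply: measurable_fun_if => //.
- exact: measurable_fun_eqr.
- rewrite setTI; have -> : (fun x : R => x == 0) @^-1` [set false] = ~` [set 0].
    by apply/seteqP; split => x /=; [move/eqP|move/eqP/negbTE].
  apply: open_continuous_measurable_fun.
    by rewrite openC; exact: closed_eq.
  by move=> x; rewrite inE => /eqP x0; exact: inv_continuous.
Qed.

Lemma measurable_funV (f : T -> R) : measurable_fun setT f ->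
  measurable_fun setT (fun x => (f x)^-1).
Proof. by move=> mf; exact: (measurableT_comp measurable_inv). Qed.

Lemma measurable_fun_div (f g : T -> R) : measurable_fun setT f ->
  measurable_fun setT g -> measurable_fun setT (fun x => f x / g x).
Proof. by move=> mf mg; apply: measurable_funM => //; exact: measurable_funV. Qed.

Lemma measurable_sqrt : measurable_fun setT (@Num.sqrt R).
Proof. by apply: continuous_measurable_fun; exact: sqrt_continuous. Qed.

Lemma measurable_bilin n (u v : T -> 'cV[R]_n) (M : 'M[R]_n) :
  (forall i, measurable_fun setT (fun x => u x i ord0)) ->
  (forall i, measurable_fun setT (fun x => v x i ord0)) ->
  measurable_fun setT (fun x => bilin (u x) M (v x)).
Proof.
move=> mu mv; rewrite (_ : (fun x => _) = fun x =>
    \sum_(j < n) (\sum_(i < n) u x i ord0 * M i j) * v x j ord0).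
  apply: measurable_sum => j; apply: measurable_funM => //.
  by apply: measurable_sum => i; apply: measurable_funM.
apply/funext => x; rewrite /bilin mxE; apply: eq_bigr => j _; rewrite mxE.
by congr (_ * _); apply: eq_bigr => i _; rewrite mxE.
Qed.

End measurable_fun_real.

(** * Quadratic forms of positive definite matrices *)

Section quadratic_form.
Context {R : realType}.

Lemma bilinZl n (a : R) (u v : 'cV[R]_n) (M : 'M[R]_n) :
  bilin (a *: u) M v = a * bilin u M v.
Proof. by rewrite /bilin linearZ/= -!scalemxAl mxE. Qed.

Lemma bilinZr n (a : R) (u v : 'cV[R]_n) (M : 'M[R]_n) :
  bilin u M (a *: v) = a * bilin u M v.
Proof. by rewrite /bilin -!scalemxAr mxE. Qed.

Lemma bilinBl n (u v w : 'cV[R]_n) (M : 'M[R]_n) :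
  bilin (u - v) M w = bilin u M w - bilin v M w.
Proof. by rewrite /bilin linearB/= !mulmxBl !mxE. Qed.

Lemma bilinBr n (u v w : 'cV[R]_n) (M : 'M[R]_n) :
  bilin u M (v - w) = bilin u M v - bilin u M w.
Proof. by rewrite /bilin !mulmxBr !mxE. Qed.

Lemma bilinC n (u v : 'cV[R]_n) (M : 'M[R]_n) : M^T = M ->
  bilin u M v = bilin v M u.
Proof.
move=> MT; transitivity ((u^T *m M *m v)^T ord0 ord0).
  by rewrite [RHS]mxE.
by rewrite !trmx_mul trmxK MT mulmxA.
Qed.

Lemma posdef_unit n (C : 'M[R]_n) : posdef C -> C \in unitmx.
Proof.
move=> [CT Cpos]; rewrite unitmxE unitfE; apply/det0P => -[v v0 vC].
have := Cpos v^T; rewrite /bilin trmxK vC mul0mx mxE ltxx => /(_ _)/negP.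
by apply=> //; rewrite -(inj_eq trmx_inj) trmxK trmx0.
Qed.

Lemma posdef_inv n (C : 'M[R]_n) : posdef C -> posdef (invmx C).
Proof.
move=> Cpd; have Cu := posdef_unit _ _ Cpd; have [CT Cpos] := Cpd.
have iT : (invmx C)^T = invmx C by rewrite trmx_inv CT.
split=> // v v0; have := Cpos (invmx C *m v).
rewrite /bilin trmx_mul iT -!mulmxA mulKVmx// mulmxA; apply.
by apply: contra v0 => /eqP/(congr1 (mulmx C)); rewrite mulKVmx// mulmx0 => ->.
Qed.

End quadratic_form.

(** * Density of the ratios *)

Section ratio_density.
Variables (R : realType) (N : nat) (Q : 'cV[R]_3) (C : 'M[R]_3).
Hypotheses (N_gt0 : (0 < N)%N) (Cpd : posdef C).

Lemma qprime_neq0 (q : R * R) : qprime q != 0.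
Proof.
apply/eqP => /matrixP/(_ ord0 ord0); rewrite !mxE/= => /eqP.
by rewrite oner_eq0.
Qed.

Lemma z1_gt0 (q : R * R) : 0 < z1 C q.
Proof.
have [_ ipos] := posdef_inv _ _ Cpd.
by rewrite sqrtr_gt0; apply: ipos; exact: qprime_neq0.
Qed.

(** The exponent of the Gaussian density along a ray from the origin. *)
Lemma bilin_ray (q : R * R) (u : R) :
  let x := vec3 u (q.1 * u) (q.2 * u) in
  bilin (x - Q) (invmx C) (x - Q) =
  z1 C q ^+ 2 * u ^+ 2 + z2 Q C q * u + lambda1 Q C.
Proof.
move=> x; have [iT ipos] := posdef_inv _ _ Cpd.
have -> : x = u *: qprime q.
  by apply/matrixP => i j; rewrite !mxE; case: i => [[|[|[|//]]]] /= _; lra.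
rewrite bilinBl !bilinBr !bilinZl !bilinZr (bilinC _ (qprime q) Q _ iT).
rewrite /z1 sqr_sqrtr ?ltW ?ipos ?qprime_neq0// /z2 /lambda1; ring.
Qed.

(** With [k] and [w] as below, the exponent of [bilin_ray] is
    [2 * (k * u + w) ^+ 2 - 2 * w ^+ 2 + lambda1], so the integral is a
    multiple of [integral_sqr_gauss]. *)
Lemma asymp_ratio_densityE (q : R * R) :
  asymp_ratio_density Q C q = (ratio_density_formula N Q C q)%:E.
Proof.
have z_gt0 := z1_gt0 q.
have s2_gt0 : 0 < Num.sqrt 2 :> R by rewrite sqrtr_gt0.
have s2E : Num.sqrt 2 ^+ 2 = 2 :> R by rewrite sqr_sqrtr.
have sN_gt0 : 0 < Num.sqrt N%:R :> R by rewrite sqrtr_gt0 ltr0n.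
have sNE : Num.sqrt N%:R ^+ 2 = N%:R :> R by rewrite sqr_sqrtr ?ler0n.
have sp_gt0 : 0 < Num.sqrt pi :> R by rewrite sqrtr_gt0 pi_gt0.
pose k := z1 C q / Num.sqrt 2.
pose w := z2 Q C q / (2 * Num.sqrt 2 * z1 C q).
pose K := lambda2 C * expR (- (lambda1 Q C / 2)) * expR (w ^+ 2).
have k_gt0 : 0 < k by rewrite divr_gt0.
have kk : k ^+ 2 = z1 C q ^+ 2 / 2 by rewrite expr_div_n s2E.
have kw : k * w = z2 Q C q / 4.
  rewrite /k /w (_ : 4 = 2 * Num.sqrt 2 ^+ 2); last by rewrite s2E; ring.
  by field; rewrite !gt_eqF.
have k3 : k ^- 3 = 4 / (Num.sqrt 2 * z1 C q ^+ 3).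
  rewrite /k (_ : 4 = Num.sqrt 2 ^+ 4); last by rewrite (exprM _ 2 2) s2E; ring.
  by field; rewrite !gt_eqF.
have K_ge0 : 0 <= K by rewrite !mulr_ge0 ?expR_ge0 ?powR_ge0.
have integrandE u : gaussian_pdf3 Q C (vec3 u (q.1 * u) (q.2 * u)) * u ^+ 2 =
    K * (u ^+ 2 * gauss_fun (k * u + w)).
  rewrite /gaussian_pdf3 bilin_ray /K /lambda2 /gauss_fun.
  have -> : - (1 / 2) * (z1 C q ^+ 2 * u ^+ 2 + z2 Q C q * u + lambda1 Q C) =
      - (lambda1 Q C / 2) + w ^+ 2 - (k * u + w) ^+ 2.
    have -> : (k * u + w) ^+ 2 = k ^+ 2 * u ^+ 2 + 2 * (k * w) * u + w ^+ 2.
      by ring.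
    by rewrite kk kw; field.
  by rewrite !expRD; ring.
rewrite /asymp_ratio_density.
under eq_integral => u _ do rewrite integrandE EFinM.
rewrite ge0_integralZl//; last 2 first.
- apply/measurable_EFinP; apply: measurable_funTS; apply: measurable_funM => //.
  apply: (measurableT_comp (@measurable_gauss_fun R)).
  by apply: measurable_funD => //; exact: measurable_funM.
- by move=> u _; rewrite lee_fin mulr_ge0 ?sqr_ge0 ?gauss_fun_ge0.
rewrite integral_sqr_gauss// -EFinM; congr EFin.
have ysN : ycoef N Q C q * Num.sqrt N%:R = w by rewrite /ycoef divfK// gt_eqF.
have y2N : ycoef N Q C q ^+ 2 * N%:R = w ^+ 2 by rewrite -sNE -exprMn ysN.
rewrite /ratio_density_formula -[2 * _ * N%:R]mulrA y2N -[2 * _ * Num.sqrt _]mulrA ysN.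
rewrite erfcE (_ : N%:R * lambda1_tilde _ _ _ = lambda1 Q C / 2); last first.
  by rewrite /lambda1_tilde; field; rewrite pnatr_eq0 -lt0n.
rewrite k3 /K /gauss_fun (expRN (w ^+ 2)).
by field; rewrite !gt_eqF// expR_gt0.
Qed.

(** The sign is read off the integral: it is not apparent on the closed form, a
    difference of two terms. *)
Lemma ratio_density_formula_ge0 (q : R * R) : 0 <= ratio_density_formula N Q C q.
Proof.
rewrite -lee_fin -asymp_ratio_densityE; apply: integral_ge0 => u _.
by rewrite lee_fin mulr_ge0 ?sqr_ge0// mulr_ge0 ?expR_ge0// mulr_ge0 ?powR_ge0.
Qed.

Lemma measurable_ratio_density_formula :
  measurable_fun setT
    (ratio_density_formula N Q C : measurableTypeR R * measurableTypeR R -> R).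
Proof.
have mq (i : 'I_3) : measurable_fun setT
    (fun q : measurableTypeR R * measurableTypeR R => qprime q i ord0).
  case: i => [[|[|[|//]]]] i3.
  - by rewrite (_ : (fun q => _) = cst 1)//; apply/funext => q; rewrite mxE.
  - by rewrite (_ : (fun q => _) = fst)//; apply/funext => q; rewrite mxE.
  - by rewrite (_ : (fun q => _) = snd)//; apply/funext => q; rewrite mxE.
have mz1 : measurable_fun setT (z1 C : measurableTypeR R * measurableTypeR R -> R).
  by apply: (measurableT_comp (measurable_sqrt R)); exact: measurable_bilin.
have mz2 : measurable_fun setT (z2 Q C : measurableTypeR R * measurableTypeR R -> R).
  by apply: measurable_funM => //; exact: measurable_bilin.
have my : measurable_fun setT (ycoef N Q C : measurableTypeR R * measurableTypeR R -> R).
  apply: measurable_fun_div => //; apply: measurable_fun_div => //.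
  exact: measurable_funM.
have mt : measurable_fun setT
    (fun q : measurableTypeR R * measurableTypeR R => gauss_tail R (ycoef N Q C q * Num.sqrt N%:R)).
  by apply: (measurableT_comp (measurable_gauss_tail R)); exact: measurable_funM.
apply: measurable_funM.
  by apply: measurable_fun_div => //; apply: measurable_funM => //; exact: measurable_funX.
apply: measurable_funB; last by do 2 apply: measurable_funM => //.
apply: measurable_funM; last exact: measurable_funM.
apply: measurable_funM.
  apply: measurable_funM => //; apply: measurable_funD => //.
  by do 2 apply: measurable_funM => //; exact: measurable_funX.
apply: measurableT_comp => //; apply: measurable_funM => //; exact: measurable_funX.
Qed.

End ratio_density.

(** * The map from anisotropy parameters to ratios *)

Section anisotropy_map.
Context {R : realType}.
Implicit Types (p q : R * R) (a b x y : R).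

Definition angle_dom : set R := `]- (pi / 4), (pi / 4)[%classic.

Lemma cos_angle_gt0 b : angle_dom b -> 0 < cos b.
Proof.
rewrite /angle_dom/= in_itv/= => /andP[b1 b2]; have := pi_gt0 R => pi0.
by apply: cos_gt0_pihalf; apply/andP; split; lra.
Qed.

Lemma cos_2angle_gt0 b : angle_dom b -> 0 < cos (2 * b).
Proof.
rewrite /angle_dom/= in_itv/= => /andP[b1 b2].
by apply: cos_gt0_pihalf; apply/andP; split; lra.
Qed.

Lemma tan_angle_lt1 b : angle_dom b -> tan b ^+ 2 < 1.
Proof.
move=> bD; have c0 := cos_angle_gt0 _ bD; have := cos_2angle_gt0 _ bD.
rewrite -[2 * b]/(2%:R * b) mulr_natl cos_mulr2n -mulr_natl => c2.
have c2_gt0 : 0 < cos b ^+ 2 by rewrite exprn_gt0.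
have := cos2_tan2 (lt0r_neq0 c0) => E.
have : (1 + tan b ^+ 2) * cos b ^+ 2 = 1 by rewrite -E mulVf// gt_eqF.
nra.
Qed.

Lemma tan_2angle b : angle_dom b -> tan (2 * b) / 2 = tan b / (1 - tan b ^+ 2).
Proof.
move=> bD; have t1 := tan_angle_lt1 _ bD.
rewrite -[2 * b]/(2%:R * b) mulr_natl tan_mulr2n; last by rewrite gt_eqF// cos_angle_gt0.
by rewrite -mulr_natl; field; rewrite subr_eq0 gt_eqF.
Qed.

Lemma cos_2angle_inv b : angle_dom b ->
  cos (2 * b) ^- 2 = ((1 + tan b ^+ 2) / (1 - tan b ^+ 2)) ^+ 2.
Proof.
move=> bD; have t1 := tan_angle_lt1 _ bD.
rewrite cos2_tan2; last by rewrite gt_eqF// cos_2angle_gt0.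
have -> : tan (2 * b) = 2 * (tan b / (1 - tan b ^+ 2)) by rewrite -tan_2angle//; field.
by field; rewrite subr_eq0 gt_eqF.
Qed.

Lemma aniso_denom_gt0 a b : 0 < a -> 0 < a ^+ 2 + tan b ^+ 2.
Proof. by move=> a0; rewrite ltr_wpDr ?sqr_ge0// exprn_gt0. Qed.

Lemma ratios_of_aniso_sub1 p : 0 < p.1 ->
  1 - (ratios_of_aniso p).1 =
  (p.1 ^+ 2 - 1) * (1 - tan p.2 ^+ 2) / (p.1 ^+ 2 + tan p.2 ^+ 2).
Proof.
move=> p1; have D0 := aniso_denom_gt0 _ p.2 p1.
by rewrite /=; field; rewrite gt_eqF.
Qed.

(** The double-angle formula for the principal axes: along the pencil of
    parameters with a given angle, the ratios stay on a line through [(1, 0)]. *)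
Lemma ratios_of_aniso_line p : 0 < p.1 -> angle_dom p.2 ->
  (ratios_of_aniso p).2 = (1 - (ratios_of_aniso p).1) * (tan (2 * p.2) / 2).
Proof.
move=> p1 pD; rewrite ratios_of_aniso_sub1// tan_2angle//.
have t1 := tan_angle_lt1 _ pD.
have D0 := aniso_denom_gt0 _ p.2 p1.
by rewrite /=; field; rewrite !gt_eqF// subr_gt0.
Qed.

(** Solution of the equations for the ratios.  On the line [q_d = 1] they force
    [R = 1] or [theta = - pi / 4], and the first case only yields [(1, 0)]; the
    first branch is the second case.  Elsewhere the angle comes from
    [ratios_of_aniso_line] and then [R ^+ 2] solves a linear equation. *)
Definition aniso_of_ratios q : R * R :=
  if q.1 == 1 then (Num.sqrt ((1 - q.2) / (1 + q.2)), - (pi / 4))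
  else let b := atan (2 * q.2 / (1 - q.1)) / 2 in
    (Num.sqrt ((1 - q.1 * tan b ^+ 2) / (q.1 - tan b ^+ 2)), b).

Lemma aniso_of_ratiosK p : aniso_range p -> ratios_of_aniso p <> (1, 0) ->
  aniso_of_ratios (ratios_of_aniso p) = p.
Proof.
move=> [p1 p2] pn.
have D0 := aniso_denom_gt0 _ p.2 p1.
have p1sq : 0 < p.1 ^+ 2 by rewrite exprn_gt0.
have sqrtp : Num.sqrt (p.1 ^+ 2) = p.1 by rewrite sqrtr_sqr gtr0_norm.
have [pE|pD] : p.2 = - (pi / 4) \/ angle_dom p.2.
  move: p2; rewrite le_eqVlt => /andP[/orP[/eqP<-|p2 p2']]; first by left.
  by right; rewrite /angle_dom/= in_itv/= p2.
- have tE : tan p.2 = -1 by rewrite pE tanN tan_piquarter.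
  have r1 : (ratios_of_aniso p).1 = 1.
    by rewrite /= tE sqrrN expr1n mulr1 addrC divff// gt_eqF// ltr_wpDr.
  rewrite /aniso_of_ratios r1 eqxx [RHS]surjective_pairing -pE; congr (_, _).
  rewrite -[RHS]sqrtp; congr Num.sqrt; rewrite /= tE sqrrN expr1n; field.
  by apply/andP; split; rewrite gt_eqF//; lra.
- have t1 := tan_angle_lt1 _ pD; have x1 := ratios_of_aniso_sub1 _ p1.
  have yE := ratios_of_aniso_line _ p1 pD.
  have [E|xn1] := eqVneq (ratios_of_aniso p).1 1.
    exfalso; apply: pn; rewrite [LHS]surjective_pairing yE E.
    by rewrite subrr mul0r.
  rewrite /aniso_of_ratios (negbTE xn1) yE.
  have -> : 2 * ((1 - (ratios_of_aniso p).1) * (tan (2 * p.2) / 2)) /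
      (1 - (ratios_of_aniso p).1) = tan (2 * p.2).
    by field; rewrite subr_eq0 eq_sym.
  rewrite tanK; last first.
    by move: pD; rewrite /angle_dom/= !in_itv/= => /andP[? ?]; apply/andP; split; lra.
  rewrite (_ : 2 * p.2 / 2 = p.2); last by field.
  rewrite [RHS]surjective_pairing; congr (_, _).
  rewrite -[RHS]sqrtp; congr Num.sqrt; rewrite /=; field.
  have t2 : 0 < (1 - tan p.2 ^+ 2) * (1 + tan p.2 ^+ 2).
    by rewrite mulr_gt0 ?subr_gt0// ltr_wpDr ?sqr_ge0.
  apply/andP; split; rewrite gt_eqF//.
  by rewrite [ltRHS](_ : _ = (1 - tan p.2 ^+ 2) * (1 + tan p.2 ^+ 2)); last by ring.
Qed.

(** Derivative of [q_o] with respect to the angle at fixed [q_d = x]. *)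
Lemma is_derive_offdiag x b : angle_dom b ->
  is_derive b 1 (fun b => (1 - x) * (tan (2 * b) / 2)) ((1 - x) * cos (2 * b) ^- 2).
Proof.
move=> bD; have c2 := cos_2angle_gt0 _ bD.
have dt := @is_derive1_comp R tan ( *%R 2) b _ _ (is_derive_tan (lt0r_neq0 c2))
  (is_deriveZ 2 (is_derive_id b 1)).
rewrite (_ : (fun b => _) = ((1 - x) / 2) *: (tan \o ( *%R 2))); last first.
  by apply/funext => z; rewrite /= mulrA mulrAC.
apply: (is_derive_eq (is_deriveZ ((1 - x) / 2) dt)).
by rewrite /GRing.scale/=; field; rewrite gt_eqF.
Qed.

Lemma continuous_offdiag_derive x b : angle_dom b ->
  {for b, continuous (fun b => (1 - x) * cos (2 * b) ^- 2)}.
Proof.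
move=> bD; have c2 := cos_2angle_gt0 _ bD.
apply: cvgM; first exact: cvg_cst.
apply: (@continuousV _ _ (fun b => cos (2 * b) ^+ 2)); first by rewrite expf_neq0// gt_eqF.
apply: (@continuous_comp _ _ _ (fun b => cos (2 * b)) (fun z => z ^+ 2)); last exact: exprn_continuous.
apply: (@continuous_comp _ _ _ (fun b => 2 * b) cos); last exact: continuous_cos.
exact: mulrl_continuous.
Qed.

(** Derivative of [q_d] with respect to [R] at fixed angle. *)
Lemma is_derive_diag a b : 0 < a ->
  is_derive a 1 (fun a => (ratios_of_aniso (a, b)).1)
    (2 * a * (tan b ^+ 4 - 1) / (a ^+ 2 + tan b ^+ 2) ^+ 2).
Proof.
move=> a0; have D0 := aniso_denom_gt0 _ b a0; set t := tan b in D0 *.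
have dsq := is_deriveX 2 (is_derive_id a 1).
have dn := is_deriveD (is_derive_cst (1:R) a 1) (is_deriveZ (t ^+ 2) dsq).
have dd := is_deriveD dsq (is_derive_cst (t ^+ 2) a 1).
have dV := @is_deriveV R ((@id R) ^+ 2 + cst (t ^+ 2)) a _ _ (lt0r_neq0 D0) dd.
rewrite (_ : (fun a => _) = (cst 1 + t ^+ 2 *: (@id R) ^+ 2) *
    (fun y => ((id ^+ 2 + cst (t ^+ 2)) y)^-1)); last first.
  by apply/funext => z; rewrite /= -/t [_ * t ^+ 2]mulrC.
apply: (is_derive_eq (is_deriveM dn dV)).
rewrite /GRing.scale/= !fctE/= /GRing.scale/=; field.
by rewrite gt_eqF.
Qed.

Lemma continuous_diag_derive a b : 0 < a ->
  {for a, continuous (fun a => 2 * a * (tan b ^+ 4 - 1) / (a ^+ 2 + tan b ^+ 2) ^+ 2)}.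
Proof.
move=> a0; have D0 := aniso_denom_gt0 _ b a0; set t := tan b in D0 *.
apply: cvgM.
  by apply: cvgM; [exact: mulrl_continuous|exact: cvg_cst].
apply: (@continuousV _ _ (fun a => (a ^+ 2 + t ^+ 2) ^+ 2)); first by rewrite expf_neq0// gt_eqF.
apply: (@continuous_comp _ _ _ (fun a => a ^+ 2 + t ^+ 2) (fun z => z ^+ 2)); last exact: exprn_continuous.
apply: cvgD; [exact: exprn_continuous|exact: cvg_cst].
Qed.

Definition aniso_jacobian p : R :=
  2 * p.1 * `|p.1 ^+ 2 - 1| / (p.1 ^+ 2 * cos p.2 ^+ 2 + sin p.2 ^+ 2) ^+ 3.

(** The Jacobian determinant is the product of the derivatives of the two
    successive substitutions, because [(R, theta) |-> (q_d, theta)] and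
    [(q_d, theta) |-> (q_d, q_o)] have triangular differentials. *)
Lemma aniso_jacobianE a b : 0 < a -> angle_dom b ->
  aniso_jacobian (a, b) =
  `|(1 - (ratios_of_aniso (a, b)).1) * cos (2 * b) ^- 2| *
  `|2 * a * (tan b ^+ 4 - 1) / (a ^+ 2 + tan b ^+ 2) ^+ 2|.
Proof.
move=> a0 bD; have c0 := cos_angle_gt0 _ bD; have t1 := tan_angle_lt1 _ bD.
have D0 := aniso_denom_gt0 _ b a0.
rewrite -normrM ratios_of_aniso_sub1// cos_2angle_inv//= /aniso_jacobian/=.
have tE : 1 + tan b ^+ 2 = cos b ^- 2 by rewrite cos2_tan2// gt_eqF.
have DE : a ^+ 2 * cos b ^+ 2 + sin b ^+ 2 = (a ^+ 2 + tan b ^+ 2) / (1 + tan b ^+ 2).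
  by rewrite tE /tan; field; rewrite gt_eqF.
rewrite DE; set t := tan b in t1 D0 *.
have t2 : 0 < 1 + t ^+ 2 by rewrite ltr_wpDr ?sqr_ge0.
have -> : (a ^+ 2 - 1) * (1 - t ^+ 2) / (a ^+ 2 + t ^+ 2) *
    ((1 + t ^+ 2) / (1 - t ^+ 2)) ^+ 2 *
    (2 * a * (t ^+ 4 - 1) / (a ^+ 2 + t ^+ 2) ^+ 2) =
    (a ^+ 2 - 1) * - (2 * a * ((1 + t ^+ 2) / (a ^+ 2 + t ^+ 2)) ^+ 3).
  by field; rewrite gt_eqF//= gt_eqF ?subr_gt0.
rewrite normrM normrN [`|2 * a * _|]ger0_norm; last first.
  apply: mulr_ge0; first by rewrite mulr_ge0// ltW.
  by rewrite exprn_ge0// divr_ge0// ltW.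
by field; rewrite !gt_eqF.
Qed.

End anisotropy_map.


(** * Change of variables in the plane *)

Section aniso_image.
Context {R : realType}.
Local Notation mu := (@lebesgue_measure R).
Local Notation T2 := (measurableTypeR R * measurableTypeR R)%type.

Definition aniso_preimage (A : set (R * R)) : set (R * R) :=
  [set q | exists2 p, A p & aniso_statistics q p].

Lemma aniso_preimageE (A : set (R * R)) : A `<=` @aniso_range R ->
  aniso_preimage A = @ratios_of_aniso R @` A.
Proof.
move=> AR; apply/seteqP; split => q [p Ap]; first by case=> _ _ _ ->; exists p.
move=> <-; exists p => //; have [p1 p2] := AR _ Ap; split => //; first exact: ltW.
by rewrite gt_eqF// aniso_denom_gt0.
Qed.

Lemma measurable_tan : measurable_fun setT (@tan R).
Proof.
by apply: measurable_fun_div; apply: continuous_measurable_fun => x;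
  [exact: continuous_sin|exact: continuous_cos].
Qed.

Lemma measurable_ratios_of_aniso :
  measurable_fun setT (@ratios_of_aniso R : T2 -> T2).
Proof.
have mt : measurable_fun setT (fun p : T2 => tan p.2 : R).
  exact: (measurableT_comp measurable_tan).
apply: measurable_fun_pair => /=; apply: measurable_fun_div.
- by apply: measurable_funD => //; apply: measurable_funM; exact: measurable_funX.
- by apply: measurable_funD; exact: measurable_funX.
- apply: measurable_funM => //; apply: measurable_funB => //.
  exact: measurable_funX.
- by apply: measurable_funD; exact: measurable_funX.
Qed.

Lemma measurable_aniso_of_ratios :
  measurable_fun setT (@aniso_of_ratios R : T2 -> T2).
Proof.
have mb : measurable_fun setT (fun q : T2 => atan (2 * q.2 / (1 - q.1)) / 2 : R).
  apply: measurable_funM => //.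
  apply: (@measurableT_comp _ _ _ _ _ _ (@atan R)).
    by apply: continuous_measurable_fun => x; exact: continuous_atan.
  by apply: measurable_fun_div; [exact: measurable_funM|exact: measurable_funB].
have mt : measurable_fun setT (fun q : T2 => tan (atan (2 * q.2 / (1 - q.1)) / 2) : R).
  exact: (measurableT_comp measurable_tan).
apply: measurable_fun_ifT; first exact: measurable_fun_eqr.
  apply: measurable_fun_pair => //=.
  apply: (measurableT_comp (measurable_sqrt R)).
  by apply: measurable_fun_div; [exact: measurable_funB|exact: measurable_funD].
apply: measurable_fun_pair => //=.
apply: (measurableT_comp (measurable_sqrt R)); apply: measurable_fun_div.
  apply: measurable_funB => //; apply: measurable_funM => //; exact: measurable_funX.
by apply: measurable_funB => //; exact: measurable_funX.
Qed.

(** Away from [(1, 0)] a point [q] is the image of a point of [A] exactly when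
    its only candidate preimage [aniso_of_ratios q] is in [A] and is mapped
    back to [q]; both conditions are measurable. *)
Lemma measurable_aniso_preimage (A : set T2) : measurable A ->
  A `<=` @aniso_range R -> measurable (aniso_preimage A : set T2).
Proof.
move=> mA AR; rewrite aniso_preimageE//.
pose E : set T2 := [set q | ratios_of_aniso (aniso_of_ratios q) = q].
have mE : measurable E.
  pose rr : T2 -> T2 := fun q => ratios_of_aniso (aniso_of_ratios q).
  have mrr : measurable_fun setT rr.
    exact: (measurableT_comp measurable_ratios_of_aniso measurable_aniso_of_ratios).
  have m1 : measurable_fun setT (fun q : T2 => (rr q).1 == q.1).
    by apply: measurable_fun_eqr => //; exact: measurableT_comp.
  have m2 : measurable_fun setT (fun q : T2 => (rr q).2 == q.2).
    by apply: measurable_fun_eqr => //; exact: measurableT_comp.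
  have := measurable_and m1 m2 => /(_ measurableT [set true] _).
  rewrite setTI (_ : _ @^-1` _ = E)//; first by apply.
  apply/seteqP; split => q /=.
    move=> /andP[/eqP e1 /eqP e2].
    by apply/eqP; rewrite -pair_eqE; apply/andP; split; apply/eqP.
  move=> Eq; apply/andP; split; apply/eqP; first exact: (congr1 fst Eq).
  exact: (congr1 snd Eq).
pose one0 : set T2 := [set (1, 0)].
have m10 : measurable one0.
  rewrite (_ : one0 = [set 1] `*` [set 0]).
    by apply: measurableX; exact: measurable_set1.
  by apply/seteqP; split => -[x y] /= [-> ->].
have -> : @ratios_of_aniso R @` A =
    ((@aniso_of_ratios R : T2 -> T2) @^-1` A `&` E `\` one0) `|`
    (one0 `&` @ratios_of_aniso R @` A).
  apply/seteqP; split => q.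
    move=> [p Ap <-]; have [e|ne] := pselect (ratios_of_aniso p = (1, 0)).
      by right; split => //; exists p.
    left; have pK := aniso_of_ratiosK _ (AR _ Ap) ne.
    by split => //; split; rewrite /E/= pK.
  by move=> [[[/= Aq Eq] _]|[_ //]]; exists (aniso_of_ratios q).
apply: measurableU.
  apply: measurableD => //; apply: measurableI => //.
  by rewrite -[X in measurable X]setTI; exact: measurable_aniso_of_ratios.
have [Aone|nA] := pselect ((@ratios_of_aniso R @` A) (1, 0)).
  by rewrite (_ : _ `&` _ = one0)//; apply/setIidl => q ->.
by rewrite (_ : _ `&` _ = set0)//; apply/seteqP; split => q // -[/= ->].
Qed.

Lemma measurable_aniso_jacobian :
  measurable_fun setT (@aniso_jacobian R : T2 -> R).
Proof.
have mc : measurable_fun setT (fun p : T2 => cos p.2 : R).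
  apply: (@measurableT_comp _ _ _ _ _ _ (@cos R)) => //.
  by apply: continuous_measurable_fun => x; exact: continuous_cos.
have ms : measurable_fun setT (fun p : T2 => sin p.2 : R).
  apply: (@measurableT_comp _ _ _ _ _ _ (@sin R)) => //.
  by apply: continuous_measurable_fun => x; exact: continuous_sin.
apply: measurable_fun_div.
  apply: measurable_funM; first exact: measurable_funM.
  apply: measurableT_comp => //; apply: measurable_funB => //.
  exact: measurable_funX.
apply: measurable_funX; apply: measurable_funD.
  by apply: measurable_funM; exact: measurable_funX.
exact: measurable_funX.
Qed.

Lemma aniso_jacobian_ge0 p : @aniso_range R p -> 0 <= aniso_jacobian p.
Proof.
move=> [p1 _]; apply: divr_ge0; first by rewrite !mulr_ge0// ltW.
by rewrite exprn_ge0// addr_ge0 ?sqr_ge0// mulr_ge0 ?sqr_ge0.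
Qed.

Section change_of_variables.
Variables (g : R * R -> \bar R) (A : set (R * R)).
Hypotheses (mg : measurable_fun setT (g : T2 -> \bar R)) (g0 : forall q, (0 <= g q)%E).
Hypotheses (mA : measurable (A : set T2)) (AR : A `<=` @aniso_range R).

(* [G] is the integrand in the coordinates [(q_d, q_o)], and [H] the same
   integrand in the intermediate coordinates [(q_d, theta)], including the
   derivative of the substitution. *)
Let G : T2 -> \bar R := g \_ (aniso_preimage A).

Let mG : measurable_fun setT G.
Proof.
apply/(measurable_restrictT g); first exact: measurable_aniso_preimage.
exact: measurable_funTS.
Qed.

Let G0 q : (0 <= G q)%E.
Proof. by apply: erestrict_ge0 => x _. Qed.

Let h (b : R) : R := tan (2 * b) / 2.
Let cos2V (b : R) : R := cos (2 * b) ^- 2.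

Let mh : measurable_fun setT h.
Proof.
by apply: measurable_funM => //; apply: (measurableT_comp measurable_tan); exact: measurable_funM.
Qed.

Let mcos2V : measurable_fun setT cos2V.
Proof.
apply: measurable_funV; apply: measurable_funX.
apply: (@measurableT_comp _ _ _ _ _ _ (@cos R)); last exact: measurable_funM.
by apply: continuous_measurable_fun => x; exact: continuous_cos.
Qed.

Let Hf (z : T2) : \bar R :=
  (G (z.1, (1 - z.1) * h z.2)%R * `|(1 - z.1) * cos2V z.2|%R%:E)%E.

Let H : T2 -> \bar R := Hf \_ (setT `*` @angle_dom R).

Let mH : measurable_fun setT H.
Proof.
apply/(measurable_restrictT Hf).
  by apply: measurableX => //; exact: measurable_itv.
apply: measurable_funTS; apply: emeasurable_funM.
  apply: (measurableT_comp mG); apply: measurable_fun_pair => //=.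
  by apply: measurable_funM; [exact: measurable_funB|exact: measurableT_comp].
apply/measurable_EFinP; apply: measurableT_comp => //.
by apply: measurable_funM; [exact: measurable_funB|exact: measurableT_comp].
Qed.

Let H0 z : (0 <= H z)%E.
Proof. by apply: erestrict_ge0 => x _; rewrite mule_ge0// lee_fin. Qed.

(** At fixed [q_d != 1] the angle ]-pi/4, pi/4[ is mapped onto the whole line of
    values of [q_o]. *)
Let subst_offdiag (x : R) : x <> 1 ->
  (\int[mu]_y G (x, y) = \int[mu]_b H (x, b))%E.
Proof.
move=> x1; have x1' : 1 - x != 0 by rewrite subr_eq0 eq_sym; apply/eqP.
have pi4 : 0 < pi / 4 :> R by rewrite divr_gt0// pi_gt0.
pose c n : R := pi / 4 * (1 - n.+2%:R^-1).
have c0 n : - c n < c n.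
  rewrite -subr_gt0 opprK -mulr2n mulrn_wgt0// mulr_gt0// subr_gt0.
  by rewrite invf_lt1 ?ltr0n// ltr1n.
have ndc : nondecreasing_seq c.
  by move=> m n mn; rewrite ler_pM2l// lerD2l lerN2 lef_pV2 ?posrE ?ltr0n// ler_nat.
have nic : nonincreasing_seq (fun n => - c n) by move=> i j ij; rewrite lerN2; exact: ndc.
have UE : \bigcup_n `[- c n, c n]%classic = @angle_dom R by rewrite -itv_sym_bigcup.
have mGx : measurable_fun setT (fun y : measurableTypeR R => G (x, y)).
  by apply: (measurableT_comp mG); exact: measurable_fun_pair.
rewrite (ge0_integral_subst R (fun n => - c n) c c0 nic ndc
  (fun b => (1 - x) * h b) (fun b => (1 - x) * cos2V b) (fun y => G (x, y)) _ _ _ mGx).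
- rewrite UE integral_mkcond; apply: eq_integral => b _.
  rewrite patchE /H patchE; congr (if _ then _ else _).
  by apply/idP/idP; rewrite !inE => -[].
- by move=> b; rewrite UE; exact: is_derive_offdiag.
- by move=> b; rewrite UE; exact: continuous_offdiag_derive.
- rewrite UE; have [x_lt1|x_gt1] : (0 < 1 - x \/ 1 - x < 0).
    by apply/orP; rewrite orbC -neq_lt.
  + by left=> b bD; rewrite mulr_gt0// invr_gt0 exprn_gt0// cos_2angle_gt0.
  + by right=> b bD; rewrite nmulr_rlt0// invr_gt0 exprn_gt0// cos_2angle_gt0.
- by [].
- move=> y []; rewrite UE; exists (atan (2 * y / (1 - x)) / 2).
    rewrite /angle_dom/= in_itv/=.
    have := atan_gtNpi2 (2 * y / (1 - x)); have := atan_ltpi2 (2 * y / (1 - x)).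
    by move=> ? ?; apply/andP; split; lra.
  rewrite /h (_ : 2 * (_ / 2) = atan (2 * y / (1 - x))); last by field.
  by rewrite atanK; field.
Qed.

(** At fixed angle in ]-pi/4, pi/4[ the variable [q_d] is replaced by [R].  For
    [R != 1], the point [(R, theta)] is in [A] exactly when its image is in
    [aniso_preimage A], by injectivity; for [R = 1] both sides vanish with the
    Jacobian. *)
Let subst_diag (b : R) : b <> - (pi / 4) ->
  (\int[mu]_a ((fun p => g (ratios_of_aniso p) * (aniso_jacobian p)%:E) \_ A) (a, b) =
   \int[mu]_x H (x, b))%E.
Proof.
move=> b4.
have [bD|bD] := pselect (angle_dom b); last first.
  rewrite !integral0_eq// => x _.
    by rewrite /H patchE ifF//; apply/negP; rewrite inE => -[].
  rewrite patchE ifF//; apply/negP; rewrite inE => /AR[_ /= bR]; apply: bD.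
  rewrite /angle_dom/= in_itv/=; case/andP: bR => + ->; rewrite le_eqVlt.
  by move=> /predU1P[/esym//|->].
pose F a := (ratios_of_aniso (a, b)).1.
pose f a := 2 * a * (tan b ^+ 4 - 1) / (a ^+ 2 + tan b ^+ 2) ^+ 2.
pose u n : R := n.+2%:R^-1.
pose v n : R := n.+2%:R.
have uv n : u n < v n.
  by rewrite /u /v (@lt_trans _ _ 1)// ?ltr1n// invf_lt1 ?ltr0n// ltr1n.
have niu : nonincreasing_seq u.
  by move=> m n mn; rewrite /u lef_pV2 ?posrE ?ltr0n// ler_nat.
have ndv : nondecreasing_seq v by move=> m n mn; rewrite /v ler_nat.
have UE : \bigcup_n `[u n, v n]%classic = `]0, +oo[%classic by rewrite -itv_pos_bigcup.
have UP a : `]0, +oo[%classic a -> 0 < a by rewrite /= in_itv/= andbT.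
have mHb : measurable_fun setT (fun x : measurableTypeR R => H (x, b)).
  by apply: (measurableT_comp mH); exact: measurable_fun_pair.
have lineE a : 0 < a -> (F a, (1 - F a) * h b) = ratios_of_aniso (a, b).
  by move=> a0; rewrite [RHS]surjective_pairing (ratios_of_aniso_line (a, b)).
have HE x : H (x, b) = Hf (x, b).
  by rewrite /H patchE ifT// inE.
rewrite [RHS](ge0_integral_subst R u v uv niu ndv F f (fun x => H (x, b)) _ _ _ mHb).
- rewrite UE [RHS]integral_mkcond; apply: eq_integral => a _; rewrite [RHS]patchE.
  case: ifPn => [|na]; last first.
    rewrite patchE ifF//; apply/negP; rewrite inE => /AR[/= a0 _].
    by move/negP: na; apply; rewrite inE /= in_itv/= a0.
  rewrite inE => /UP a0.
  have JE := aniso_jacobianE a b a0 bD.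
  rewrite HE /Hf /= -/(F a) -/(f a) -muleA -EFinM -JE lineE// /G !patchE.
  have [F1|F1] := pselect (F a = 1).
    have -> : aniso_jacobian (a, b) = 0 by rewrite JE -/(F a) F1 subrr mul0r normr0 mul0r.
    by rewrite !mule0; case: ifP.
  rewrite (_ : ((a, b) \in A) = (ratios_of_aniso (a, b) \in aniso_preimage A)).
    by case: ifP => //; rewrite mul0e.
  apply/idP/idP; rewrite !inE aniso_preimageE//.
  move=> [p Ap pE].
  have rn : ratios_of_aniso (a, b) <> (1, 0) by move=> /(congr1 fst).
  have abR : aniso_range (a, b).
    split => //=; move: bD; rewrite /angle_dom/= in_itv/= => /andP[bl ->].
    by rewrite ltW.
  by rewrite -(aniso_of_ratiosK _ abR rn) -pE aniso_of_ratiosK ?pE//; exact: AR.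
- by move=> a; rewrite UE => /UP; exact: is_derive_diag.
- by move=> a; rewrite UE => /UP; exact: continuous_diag_derive.
- right=> a; rewrite UE => /UP a0; have t1 := tan_angle_lt1 _ bD.
  rewrite /f pmulr_llt0; last first.
    by rewrite invr_gt0 exprn_gt0// aniso_denom_gt0.
  rewrite pmulr_rlt0 ?mulr_gt0// subr_lt0 (exprM _ 2 2).
  by rewrite expr_lt1// ?sqr_ge0.
- by [].
- move=> x; rewrite UE => Fx; rewrite HE /Hf/=.
  have [->|/eqP x1] := eqVneq x 1; first by rewrite subrr !mul0r normr0 mule0.
  have x1' : 1 - x != 0 by rewrite subr_eq0 eq_sym; apply/eqP.
  rewrite /G patchE; case: ifPn => [|_]; last by rewrite mul0e.
  rewrite inE aniso_preimageE// => -[p Ap pE]; exfalso; apply: Fx.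
  have pR := AR _ Ap.
  have rn : ratios_of_aniso p <> (1, 0) by rewrite pE => /(congr1 fst)/= /x1.
  have pK := aniso_of_ratiosK _ pR rn.
  have p2 : p.2 = b.
    rewrite -pK pE /aniso_of_ratios/= ifF/=; last by apply/negbTE/eqP.
    rewrite /h (_ : 2 * ((1 - x) * (tan (2 * b) / 2)) / (1 - x) = tan (2 * b)); last by field.
    rewrite tanK; first by field.
    by move: bD; rewrite /angle_dom/= !in_itv/= => /andP[? ?]; apply/andP; split; lra.
  exists p.1; first by case: pR => p1 _; rewrite /= in_itv/= andbT.
  by rewrite /F -p2 -surjective_pairing pE.
Qed.

Lemma integral_aniso_preimage :
  (\int[leb2 R]_(q in aniso_preimage A) g q =
   \int[leb2 R]_(p in A) (g (ratios_of_aniso p) * (aniso_jacobian p)%:E))%E.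
Proof.
pose Kf (p : T2) : \bar R := (g (ratios_of_aniso p) * (aniso_jacobian p)%:E)%E.
pose K : T2 -> \bar R := Kf \_ A.
have K0 p : (0 <= K p)%E.
  apply: erestrict_ge0 => {}p Ap; rewrite mule_ge0// lee_fin.
  by apply: aniso_jacobian_ge0; exact: AR.
have mK : measurable_fun setT K.
  apply/(measurable_restrictT Kf) => //; apply: measurable_funTS.
  apply: emeasurable_funM; first exact: (measurableT_comp mg measurable_ratios_of_aniso).
  by apply/measurable_EFinP; exact: measurable_aniso_jacobian.
rewrite [LHS]integral_mkcond [RHS]integral_mkcond -/G -/K.
rewrite fubini_tonelli1// fubini_tonelli2//.
transitivity (\int[mu]_x \int[mu]_b H (x, b))%E.
  apply: (eq_integral_except 1); last exact: subst_offdiag.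
  exact: (measurable_fun_fubini_tonelli_F G).
rewrite fubini_tonelli//; apply/esym.
apply: (eq_integral_except (- (pi / 4))); last exact: subst_diag.
exact: (measurable_fun_fubini_tonelli_G K).
Qed.

End change_of_variables.

End aniso_image.

(** * Joint density of the anisotropy statistics *)

Section aniso_density.
Variables (R : realType) (N : nat) (Q : 'cV[R]_3) (C : 'M[R]_3).
Hypotheses (N_gt0 : (0 < N)%N) (Cpd : posdef C).
Local Notation T2 := (measurableTypeR R * measurableTypeR R)%type.

Lemma aniso_density_formulaE p : aniso_density_formula N Q C p =
  ratio_density_formula N Q C (ratios_of_aniso p) * aniso_jacobian p.
Proof. by rewrite /aniso_density_formula /aniso_jacobian; ring. Qed.

Lemma aniso_density_formulaP :
  is_asymp_aniso_density Q C (aniso_density_formula N Q C).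
Proof.
have mr : measurable_fun setT (ratio_density_formula N Q C : T2 -> R).
  exact: measurable_ratio_density_formula.
have fE : aniso_density_formula N Q C =
    fun p => ratio_density_formula N Q C (ratios_of_aniso p) * aniso_jacobian p.
  by apply/funext => p; exact: aniso_density_formulaE.
split.
- rewrite fE; apply: (@measurable_funTS _ _ T2).
  apply: measurable_funM; last exact: measurable_aniso_jacobian.
  exact: (measurableT_comp mr measurable_ratios_of_aniso).
- move=> p pR; rewrite aniso_density_formulaE mulr_ge0//.
    exact: ratio_density_formula_ge0.
  exact: aniso_jacobian_ge0.
- move=> A mA AR; rewrite /asymp_aniso_law.
  under eq_integral => q _ do rewrite (asymp_ratio_densityE R N Q C N_gt0 Cpd).
  rewrite (integral_aniso_preimage (EFin \o ratio_density_formula N Q C) A)//.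
  + by apply: eq_integral => p _; rewrite aniso_density_formulaE.
  + exact/measurable_EFinP.
  + by move=> q; rewrite lee_fin; exact: ratio_density_formula_ge0.
Qed.

End aniso_density.

Theorem theorem3
  (d : measure_display) (T : measurableType d) (R : realType)
  (P : probability T R)
  (D : set (R * R)) (X : R * R -> {RV P >-> R})
  (m : R) (c : R * R -> R) (dX : 'I_2 -> R * R -> {RV P >-> R})
  (N : nat) (s : 'I_N -> R * R) (s0 : R * R)
  (hD : open D)
  (hgauss : gaussian_field D X)
  (hstat : wide_sense_stationary D X m c)
  (hdiff : ms_gradient D X dX)
  (hshort : short_ranged c)
  (hspec : spectral_decay c)
  (hN : (0 < N)%N)
  (hs : forall k, D (s k))
  (hs0 : D s0)
  (hC : posdef (sample_grad_cov dX s)) :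
  let Q := mean_grad_tensor dX s0 in
  let C := sample_grad_cov dX s in
  (forall q : R * R,
     asymp_ratio_density Q C q = (ratio_density_formula N Q C q)%:E) /\
  is_asymp_aniso_density Q C (aniso_density_formula N Q C).
Proof.
move=> Q C; split; last exact: aniso_density_formulaP.
by move=> q; exact: asymp_ratio_densityE.
Qed.
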